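(* Let $A_1,\ldots,A_m\in\mathcal{M}_d(\mathbb{C})^+$ be positive definite matrices and let $k\ge1$. Let $(B_1,\ldots,B_{km})$ be the list consisting of $k$ consecutive copies of $(A_1,\ldots,A_m)$, i.e. $B_{qm+i}=A_i$ for $0\le q\le k-1$ and $1\le i\le m$. Let $\sigma=\{\sigma_j\}_{j\in\mathbb{N}}$ be a sequence of permutations of $\{1,\ldots,km\}$ and consider the sequence $$\mathbf{A}_\sigma^{(k)}=(B_{\sigma_1(1)},\ldots,B_{\sigma_1(km)},B_{\sigma_2(1)},\ldots,B_{\sigma_2(km)},B_{\sigma_3(1)},\ldots).$$ Then there exists $L>0$ such that for all $n\ge1$, $$\delta^2\big(S_n(\mathbf{A}_\sigma^{(k)}),G(A_1,\ldots,A_m)\big)\le\frac{L}{n}.$$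
   Context: $\mathbb{N}=\{1,2,3,\ldots\}$. $\mathcal{M}_d(\mathbb{C})^+$ is the set of (strictly) positive definite $d\times d$ complex Hermitian matrices, an open cone in the real vector space of selfadjoint matrices. For a piecewise smooth path $\alpha:[a,b]\to\mathcal{M}_d(\mathbb{C})^+$ its length is $L(\alpha)=\int_a^b\|\alpha^{-1/2}(t)\alpha'(t)\alpha^{-1/2}(t)\|_2\,dt$, where $\|\cdot\|_2$ is the Frobenius (Hilbert-Schmidt) norm, and $\delta(A,B)$ is the infimum of $L(\alpha)$ over piecewise smooth paths $\alpha$ connecting $A$ with $B$. The geodesic from $A$ to $B$ is $A\#_tB=A^{1/2}(A^{-1/2}BA^{-1/2})^tA^{1/2}$, $t\in[0,1]$. The geometric mean (barycenter, least square mean) of $A_1,\ldots,A_m\in\mathcal{M}_d(\mathbb{C})^+$ is the unique minimizer $G(A_1,\ldots,A_m)=\operatorname{argmin}_{C\in\mathcal{M}_d(\mathbb{C})^+}\sum_{j=1}^{m}\delta^2(A_j,C)$ (it exists and is unique). For a sequence $A=(A_n)_{n\in\mathbb{N}}$ in $\mathcal{M}_d(\mathbb{C})^+$, the inductive means are defined by $S_1(A)=A_1$ and $S_n(A)=S_{n-1}(A)\#_{\frac1n}A_n$ for $n\ge2$. *)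

(* Defs.v *)
From mathcomp Require Import all_boot all_order all_fingroup all_algebra.
From mathcomp Require Import complex.
From mathcomp Require Import all_classical all_reals all_analysis.

Set Implicit Arguments.
Unset Strict Implicit.
Unset Printing Implicit Defensive.

Import Order.TTheory GRing.Theory Num.Theory.
Import numFieldNormedType.Exports.

Local Open Scope classical_set_scope.
Local Open Scope ring_scope.
Local Open Scope sesquilinear_scope.

(* Strictly positive definite Hermitian matrices.  In the partial order of
   R[i], [0 < z] means that z is real and positive. *)
Definition posdefmx (R : realType) (d : nat) (A : 'M[R[i]]_d) : Prop :=
  A \is hermsymmx /\
  forall v : 'cV[R[i]]_d, v != 0 -> 0 < (v^t* *m A *m v) 0 0.

(* A^t through the spectral decomposition A = P^-1 * diag(x) * P, P unitary;
   only meaningful for Hermitian A with positive (real) eigenvalues. *)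
Definition powmx (R : realType) (d : nat) (A : 'M[R[i]]_d) (t : R) :
    'M[R[i]]_d :=
  invmx (spectralmx A)
  *m diag_mx (map_mx (fun x : R[i] => ((complex.Re x `^ t)%:C)%C)
                     (spectral_diag A))
  *m spectralmx A.

Definition frobenius_norm (R : realType) (d : nat) (X : 'M[R[i]]_d) : R :=
  Num.sqrt (\sum_i \sum_j ComplexField.Normc.normc (X i j) ^+ 2).

Definition mx_geodesic (R : realType) (d : nat) (A B : 'M[R[i]]_d) (t : R) :
    'M[R[i]]_d :=
  powmx A 2^-1 *m powmx (powmx A (- 2^-1) *m B *m powmx A (- 2^-1)) t
  *m powmx A 2^-1.

Definition smooth (R : realType) (f : R -> R) : Prop :=
  forall (n : nat) (x : R), derivable (derive1n n f) x 1.

Definition smooth_path (R : realType) (d : nat) (f : R -> 'M[R[i]]_d) : Prop :=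
  forall i j, smooth (fun t => complex.Re (f t i j)) /\
              smooth (fun t => complex.Im (f t i j)).

(* Smoothness on a closed interval is up to the end points: the restriction is
   that of a smooth function defined on the whole line. *)
Definition piecewise_smooth (R : realType) (d : nat) (a b : R)
    (f : R -> 'M[R[i]]_d) : Prop :=
  exists2 s : seq R, itv_partition a b s &
    forall k : nat, (k < size s)%N ->
      exists2 g : R -> 'M[R[i]]_d, smooth_path g &
        {in `[nth a (a :: s) k, nth a s k], f =1 g}.

Definition deriv_path (R : realType) (d : nat) (f : R -> 'M[R[i]]_d) (t : R) :
    'M[R[i]]_d :=
  \matrix_(i, j) (derive1 (fun u => complex.Re (f u i j)) t
                  +i* derive1 (fun u => complex.Im (f u i j)) t)%C.

(* [deriv_path f] is unspecified at a, b and the finitely many break points,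
   a Lebesgue-null set. *)
Definition path_length (R : realType) (d : nat) (a b : R)
    (f : R -> 'M[R[i]]_d) : R :=
  \int[lebesgue_measure]_(t in `[a, b])
    frobenius_norm (powmx (f t) (- 2^-1) *m deriv_path f t
                    *m powmx (f t) (- 2^-1)).

Definition path_connecting (R : realType) (d : nat) (A B : 'M[R[i]]_d)
    (a b : R) (f : R -> 'M[R[i]]_d) : Prop :=
  [/\ a < b, piecewise_smooth a b f,
      forall t, t \in `[a, b] -> posdefmx (f t), f a = A & f b = B].

Definition mx_dist (R : realType) (d : nat) (A B : 'M[R[i]]_d) : R :=
  inf [set l : R | exists a b f,
         path_connecting A B a b f /\ l = path_length a b f].

(* For positive definite A_i the minimizer exists and is unique; 1 is an
   irrelevant default value. *)
Definition geometric_mean (R : realType) (d m : nat)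
    (A : 'I_m -> 'M[R[i]]_d) : 'M[R[i]]_d :=
  xget 1%:M [set C | posdefmx C /\
    forall D, posdefmx D ->
      \sum_(j < m) mx_dist (A j) C ^+ 2 <= \sum_(j < m) mx_dist (A j) D ^+ 2].

(* Sequences are indexed from 1; the value at index 0 is never used. *)
Fixpoint inductive_mean (R : realType) (d : nat) (X : nat -> 'M[R[i]]_d)
    (n : nat) : 'M[R[i]]_d :=
  match n with
  | 0%N | 1%N => X 1%N
  | n'.+1 => mx_geodesic (inductive_mean X n') (X n) (n%:R)^-1
  end.

Lemma repeat_index_subproof (k m : nat) (i : 'I_(k * m)) : (i %% m < m)%N.
Proof. by rewrite ltn_mod; case: m i => [|//] [i /=]; rewrite muln0. Qed.

(* The list (A_1, ..., A_m) repeated k times, indices shifted to start at 0. *)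
Definition repeat_family (T : Type) (k m : nat) (A : 'I_m -> T)
    (i : 'I_(k * m)) : T :=
  A (Ordinal (repeat_index_subproof i)).

(* Main.v *)
(** Put rho(A, B) = || log (A^(-1/2) B A^(-1/2)) ||_2.

    The distance is rho.  The inequality
    rho(A, B)^2 <= tr (A^-1 (B - A) B^-1 (B - A)) shows that along a path rho
    grows, to first order, at most like the length; the paths X^* exp(t K) X
    with K real diagonal attain the bound.

    rho is nonpositively curved.  This follows from the exponential metric
    increasing property rho(e^H, e^K) >= || H - K ||_2, which by repeated
    halving of H and K reduces to 2 rho(P, Q) <= rho(P^2, Q^2).  If x_i and y_i
    are the eigenvalues of P^-1 Q and P^-2 Q^2, the latter compares the sums of
    ln^2 of x_i^2 and of y_i, and it is obtained by integrating over c > 0 the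
    determinant inequality prod (1 + c x_i^2) <= prod (1 + c y_i).

    The rate.  Let g be the barycenter and b_n = d(g, S_n)^2.  Nonpositive
    curvature at step n gives
    (n + 1) b_(n+1) <= n b_n + d(g, X_(n+1))^2
                       - (1 - 1/(n + 1)) d(S_n, X_(n+1))^2.
    During the N = km steps that follow n = qN the means move by O(1/q), so S_n
    may be replaced by S_(qN) at the cost of an error O(1/q); as every A_j then
    occurs k times, the variance inequality
    m d(g, c)^2 <= sum_j (d(A_j, c)^2 - d(A_j, g)^2) with c = S_(qN) yields
    (q + 1) b_((q+1)N) <= (q - 1) b_(qN) + C / q, and q b_(qN) is bounded. *)

Require Import Defs.
From HB Require Import structures.
From mathcomp Require Import all_boot all_order all_fingroup all_algebra.
From mathcomp Require Import complex.
From mathcomp Require Import all_classical all_reals all_analysis.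
From mathcomp Require Import measurable_realfun.
From mathcomp Require Import ring lra.

Set Implicit Arguments.
Unset Strict Implicit.
Unset Printing Implicit Defensive.

Import Order.TTheory GRing.Theory Num.Theory.
Import numFieldNormedType.Exports.

Local Open Scope ring_scope.

(** * Barycenters and inductive means in nonpositive curvature *)

(** The metric part is stated for an abstract [dist] whose hypotheses contain no triangle
    inequality: that inequality is a consequence of [npc]. It is needed both for the rate and for
    comparing [rho] with lengths, so the curvature of [rho] is established by matrix algebra alone,
    before any path appears. The obstacle there is that [P] and [Q] do not commute, so that the
    eigenvalues of P^-2 Q^2 are not the squares of those of P^-1 Q. A determinant [\det (1 + c M)]
    sees all eigenvalues of [M] at once without ordering them. The integral over c that turns it
    into ln^2 diverges; it is replaced by Riemann sums over a bounded range of ln c, and the affine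
    terms that grow with the range cancel because the two families of eigenvalues have the same
    product. Eigenvalues are never followed along a limit: every passage to the limit is made on
    entries, traces or quadratic forms. *)

Lemma sub_sqr_le (R : realDomainType) (r p e w : R) :
  0 <= r <= w -> 0 <= p <= w -> 0 <= e -> r <= p + e ->
  r ^+ 2 - p ^+ 2 <= 2 * w * e.
Proof.
move=> /andP[r0 rw] /andP[p0 pw] e0 rpe.
have [rp|/ltW rp] := leP 0 (r - p).
  by rewrite subr_sqr mulrC ler_pM//; [exact: addr_ge0|lra|lra].
apply: (@le_trans _ _ 0); last by rewrite !mulr_ge0// (le_trans r0).
by rewrite subr_sqr mulr_le0_ge0// addr_ge0.
Qed.

Section Hadamard.
Variables (R : realType) (T : Type) (P : T -> Prop).
Variables (dist : T -> T -> R) (geo : T -> T -> R -> T).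
Hypothesis geoP : forall a b (t : R), P a -> P b -> 0 <= t <= 1 -> P (geo a b t).
Hypothesis dist_ge0 : forall a b, 0 <= dist a b.
Hypothesis dist_sym : forall a b, P a -> P b -> dist a b = dist b a.
Hypothesis dist_refl : forall a, P a -> dist a a = 0.
Hypothesis npc : forall a b c (t : R), P a -> P b -> P c -> 0 <= t <= 1 ->
  dist c (geo a b t) ^+ 2 <=
  (1 - t) * dist c a ^+ 2 + t * dist c b ^+ 2 - t * (1 - t) * dist a b ^+ 2.
Hypothesis dist_complete : forall u : nat -> T, (forall n, P (u n)) ->
  (forall e : R, 0 < e -> exists N, forall n k, (N <= n)%N -> (N <= k)%N ->
     dist (u n) (u k) <= e) ->
  exists2 l, P l & forall e : R, 0 < e -> exists N, forall n, (N <= n)%N ->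
     dist (u n) l <= e.

(* With t = p / (p + q), where p >= d(c, a) and q >= d(c, b), the left-hand side
   of the NPC inequality being nonnegative yields d(a, b)^2 <= (p + q)^2. *)
Lemma npc_triangle a b c : P a -> P b -> P c ->
  dist a b <= dist c a + dist c b.
Proof.
move=> Pa Pb Pc; apply/ler_addgt0Pr => e e0.
pose p := dist c a + e / 2; pose q := dist c b + e / 2.
have p0 : 0 < p by rewrite ltr_wpDl// divr_gt0.
have q0 : 0 < q by rewrite ltr_wpDl// divr_gt0.
have pq0 : 0 < p + q by rewrite addr_gt0.
have p0' := ltW p0; have q0' := ltW q0; have pq0' := ltW pq0.
suff : dist a b <= p + q by rewrite /p /q; lra.
have t01 : 0 <= p / (p + q) <= 1.
  by rewrite ler_pdivrMr// mul1r lerDl (ltW q0) divr_ge0// ltW.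
have := npc Pa Pb Pc t01; set t := p / (p + q).
move=> /(le_trans (sqr_ge0 _)).
have cap : dist c a ^+ 2 <= p ^+ 2.
  by rewrite ler_sqr ?nnegrE// /p lerDl divr_ge0// ltW.
have cbq : dist c b ^+ 2 <= q ^+ 2.
  by rewrite ler_sqr ?nnegrE// /q lerDl divr_ge0// ltW.
have t1 : 1 - t = q / (p + q) by rewrite /t; field; rewrite gt_eqF.
rewrite t1 => h.
have h1 : t * (q / (p + q)) * dist a b ^+ 2 <=
          q / (p + q) * p ^+ 2 + t * q ^+ 2.
  have : q / (p + q) * dist c a ^+ 2 <= q / (p + q) * p ^+ 2.
    by rewrite ler_wpM2l// divr_ge0.
  have : t * dist c b ^+ 2 <= t * q ^+ 2.
    by rewrite ler_wpM2l// divr_ge0.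
  lra.
have k0 : 0 < p * q / (p + q) ^+ 2 by rewrite divr_gt0 ?mulr_gt0 ?exprn_gt0.
rewrite -ler_sqr ?nnegrE ?(ltW pq0)// -(ler_pM2l k0).
apply: le_trans (le_trans h1 _); rewrite /t; rewrite le_eqVlt; apply/orP; left; apply/eqP.
- by field; rewrite gt_eqF.
- by field; rewrite gt_eqF.
Qed.

(** This is [npc] at [c = a], since [t - t * (1 - t)] is [t ^+ 2]. *)
Lemma dist_geo a b (t : R) : P a -> P b -> 0 <= t <= 1 ->
  dist a (geo a b t) <= t * dist a b.
Proof.
move=> Pa Pb t01; have := npc Pa Pb Pa t01.
rewrite dist_refl// expr0n/= mulr0 add0r => h.
case/andP: (t01) => t0 t1.
rewrite -ler_sqr ?nnegrE ?mulr_ge0//; apply: le_trans h _.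
by rewrite le_eqVlt; apply/orP; left; apply/eqP; ring.
Qed.

(** * Existence of barycenters and the variance inequality *)

Section Barycenter.
Variables (m : nat) (a : 'I_m -> T).
Hypotheses (m0 : (0 < m)%N) (Pa : forall j, P (a j)).

Let cost c := \sum_(j < m) dist (a j) c ^+ 2.

Lemma npc_cost c c' (t : R) : P c -> P c' -> 0 <= t <= 1 ->
  cost (geo c c' t) <= (1 - t) * cost c + t * cost c'
                       - m%:R * (t * (1 - t) * dist c c' ^+ 2).
Proof.
move=> Pc Pc' t01.
have -> : m%:R * (t * (1 - t) * dist c c' ^+ 2) =
    \sum_(j < m) (t * (1 - t) * dist c c' ^+ 2).
  by rewrite sumr_const card_ord mulr_natl.
rewrite /cost !mulr_sumr -big_split/= -sumrB.
by apply: ler_sum => j _; apply: npc.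
Qed.

Lemma cost_ge0 c : 0 <= cost c.
Proof. by apply: sumr_ge0 => j _; apply: sqr_ge0. Qed.

Lemma dist_le_sqrt_cost j c : dist (a j) c <= Num.sqrt (cost c).
Proof.
rewrite -(ger0_norm (dist_ge0 _ _)) -sqrtr_sqr ler_wsqrtr//.
rewrite /cost (bigD1 j)//= lerDl.
by apply: sumr_ge0 => i _; apply: sqr_ge0.
Qed.

(** Completeness takes the place of compactness: curvature forces a minimizing sequence to be
    Cauchy, and the triangle inequality carries the infimum over to its limit. *)
Lemma barycenter_exists : exists2 g, P g & forall c, P c -> cost g <= cost c.
Proof.
pose V := [set cost c | c in [set c | P c]]%classic.
have V0 : (V !=set0)%classic.
  by exists (cost (a (Ordinal m0))), (a (Ordinal m0)) => //=; apply: Pa.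
have lbV : has_lbound V by exists 0 => _ [c _ <-]; apply: cost_ge0.
have infV c : P c -> inf V <= cost c.
  by move=> Pc; apply: ge_inf => //; exists c.
have infV0 : 0 <= inf V by apply: lb_le_inf => // _ [c _ <-]; apply: cost_ge0.
have /choice[u uP] : forall n : nat, exists c, P c /\ cost c < inf V + n.+1%:R^-1.
  move=> n.
  have [|_ [c Pc <-] h] := @inf_adherent _ V n.+1%:R^-1 _ (conj V0 lbV).
    by rewrite invr_gt0.
  by exists c.
have mR : 1 <= m%:R :> R by rewrite ler1n.
have half : (0 <= 2^-1 :> R) && (2^-1 <= 1 :> R) by lra.
(* At the midpoint the cost is at least [inf V] and at most the average of the two costs minus
   [m%:R / 4] times the squared distance. *)
have cau n k : dist (u n) (u k) ^+ 2 <= 2 * (n.+1%:R^-1 + k.+1%:R^-1).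
  have [[Pn hn] [Pk hk]] := (uP n, uP k).
  have := npc_cost Pn Pk half; have := infV _ (geoP Pn Pk half).
  have := sqr_ge0 (dist (u n) (u k)).
  have : dist (u n) (u k) ^+ 2 <= m%:R * dist (u n) (u k) ^+ 2.
    by rewrite ler_peMl// sqr_ge0.
  rewrite mulrC; set D := dist _ _ ^+ 2; set mD := D * m%:R.
  have -> : m%:R * (2^-1 * (1 - 2^-1) * D) = mD / 4 by rewrite /mD; field.
  move: (cost (geo _ _ _)) (n.+1%:R^-1) (k.+1%:R^-1) hn hk => *; lra.
have [||g Pg gP] := dist_complete (u := u).
- by move=> n; case: (uP n).
- move=> e e0.
  have [N hN] : exists N : nat, 4 / e ^+ 2 < N.+1%:R.
    by exists (Num.truncn (4 / e ^+ 2)); apply: truncnS_gt.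
  have e20 : 0 < e ^+ 2 by rewrite exprn_gt0.
  have small n : (N <= n)%N -> n.+1%:R^-1 <= e ^+ 2 / 4.
    move=> Nn; rewrite -[e ^+ 2 / 4]invrK lef_pV2 ?posrE ?invr_gt0 ?divr_gt0//.
    rewrite invf_div; apply/ltW/(lt_le_trans hN); by rewrite ler_nat.
  exists N => n k Nn Nk.
  rewrite -ler_sqr ?nnegrE ?(ltW e0)//.
  apply: le_trans (cau _ _) _; have := small _ Nn; have := small _ Nk.
  move: (n.+1%:R^-1) (k.+1%:R^-1) => *; lra.
exists g => // c Pc; apply: le_trans _ (infV _ Pc).
(* [K] bounds all the distances [dist (a j) (u n)], because [cost (u n)] is below [inf V + 1]. *)
pose K : R := Num.sqrt (inf V + 1).
have K0 : 0 <= K by apply: sqrtr_ge0.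
apply/ler_addgt0Pr => e e0.
(* Moving by [r] changes each of the [m] squared distances by at most [2 * r * K + r ^+ 2]; the
   extra [r] pays for the excess of [cost (u n)] over [inf V]. *)
have [r r0 hr] : exists2 r, 0 < r & r + m%:R * (2 * r * K + r ^+ 2) <= e.
  pose M := m%:R * (2 * K + 1) + 1.
  have M0 : 0 < M.
    by rewrite ltr_wpDl// mulr_ge0 ?addr_ge0 ?mulr_ge0// ltW// (lt_le_trans ltr01).
  exists (Num.min 1 (e / M)); first by rewrite lt_min ltr01 divr_gt0.
  set r := Num.min _ _.
  have r1 : r <= 1 by rewrite ge_min lexx.
  have r0 : 0 < r by rewrite lt_min ltr01 divr_gt0.
  have : r * M <= e by rewrite -ler_pdivlMr// ge_min lexx orbT.
  apply: le_trans.
  have : r ^+ 2 <= r by rewrite expr2 ler_piMl// ltW.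
  have mR0 : 0 <= m%:R :> R by rewrite ler0n.
  move=> /(ler_wpM2l mR0); rewrite /M; lra.
have [N hN] := gP _ r0.
pose n := maxn N (Num.truncn r^-1).
have nN : (N <= n)%N by rewrite leq_maxl.
have rn : n.+1%:R^-1 <= r.
  rewrite -[r]invrK lef_pV2 ?posrE ?invr_gt0//.
  apply/ltW/(lt_le_trans (truncnS_gt _)).
  by rewrite ler_nat ltnS leq_maxr.
have [Pn hn] := uP n.
have dK j : dist (a j) (u n) <= K.
  apply: le_trans (dist_le_sqrt_cost _ _) _; rewrite ler_wsqrtr//.
  apply: (le_trans (ltW hn)); rewrite lerD2l invf_le1//; by rewrite ler1n.
have : cost g <= cost (u n) + m%:R * (2 * r * K + r ^+ 2).
  have -> : m%:R * (2 * r * K + r ^+ 2) = \sum_(j < m) (2 * r * K + r ^+ 2).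
    by rewrite sumr_const card_ord mulr_natl.
  rewrite /cost -big_split/=; apply: ler_sum => j _.
  have tri : dist (a j) g <= dist (a j) (u n) + r.
    have := npc_triangle (Pa j) Pg Pn; rewrite (dist_sym Pn (Pa j)).
    have := hN _ nN; lra.
  have := dist_ge0 (a j) g; have := dist_ge0 (a j) (u n); have := dK j.
  move: tri; move: (dist _ _) (dist _ _) => y x *.
  have : x ^+ 2 <= (y + r) ^+ 2 by rewrite ler_sqr ?nnegrE//; lra.
  have : y * r <= K * r by rewrite ler_wpM2r// ltW.
  lra.
move=> /le_trans -> //; apply: le_trans (lerD (ltW hn) (lexx _)) _.
by rewrite -addrA lerD2l (le_trans _ hr)// lerD2r.
Qed.

(* Compare g with geo g c t and let t tend to 0. *)
Lemma variance_ineq g c : P g -> (forall c, P c -> cost g <= cost c) -> P c ->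
  m%:R * dist g c ^+ 2 <= cost c - cost g.
Proof.
move=> Pg gmin Pc; apply/ler_addgt0Pr => e e0.
set X := m%:R * _.
have X0 : 0 <= X by rewrite mulr_ge0 ?ler0n ?sqr_ge0.
pose t := Num.min 1 (e / (X + 1)).
have X10 : 0 < X + 1 by rewrite ltr_wpDl.
have t0 : 0 < t by rewrite lt_min ltr01 divr_gt0.
have t1 : t <= 1 by rewrite ge_min lexx.
have tX : t * X <= e.
  have : t * (X + 1) <= e by rewrite -ler_pdivlMr// ge_min lexx orbT.
  lra.
have t01 : 0 <= t <= 1 by rewrite t1 ltW.
have := npc_cost Pg Pc t01; have := gmin _ (geoP Pg Pc t01).
rewrite [m%:R * _](_ : _ = t * ((1 - t) * X)); last by rewrite /X; ring.
move: (cost g) (cost c) (cost (geo _ _ _)) => x y z h1 h2.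
have : t * ((1 - t) * X) <= t * (y - x) by lra.
rewrite ler_pM2l//; lra.
Qed.

(** * Rate of convergence of the inductive means *)

Variables (N k : nat) (X : nat -> T) (S : nat -> T) (g : T).
Hypotheses (Nkm : N = (k * m)%N) (k0 : (0 < k)%N).
Hypothesis X_in : forall n, (0 < n)%N -> exists j, X n = a j.
Hypothesis X_block : forall (f : T -> R) q,
  \sum_(i < N) f (X (q * N + i).+1) = k%:R * \sum_(j < m) f (a j).
Hypothesis S1 : S 1%N = X 1%N.
Hypothesis SS : forall n, (0 < n)%N -> S n.+1 = geo (S n) (X n.+1) n.+1%:R^-1.
Hypotheses (Pg : P g) (gmin : forall c, P c -> cost g <= cost c).

Let PX n : (0 < n)%N -> P (X n).
Proof. by move=> /X_in[j ->]. Qed.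

Let inv01 n : (0 <= n.+1%:R^-1 :> R) && (n.+1%:R^-1 <= 1 :> R).
Proof. by rewrite invr_ge0 ler0n/= invf_le1// ler1n. Qed.

Let PS n : (0 < n)%N -> P (S n).
Proof.
elim: n => // -[_ _|n /(_ isT) IH _]; first by rewrite S1; apply: PX.
by rewrite SS//; apply: geoP => //; apply: PX.
Qed.

Let D := cost g.
(** [W] bounds the distances [dist (S n) (X l)]: both points stay within [Num.sqrt D] of [g]. *)
Let W : R := 2 * Num.sqrt D.
Let b n := dist g (S n) ^+ 2.

Let D0 : 0 <= D. Proof. exact: cost_ge0. Qed.
Let W0 : 0 <= W. Proof. by rewrite mulr_ge0 ?sqrtr_ge0. Qed.

Let distX n : (0 < n)%N -> dist g (X n) <= Num.sqrt D.
Proof. by move=> /X_in[j ->]; rewrite dist_sym//; apply: dist_le_sqrt_cost. Qed.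

Let distX2 n : (0 < n)%N -> dist g (X n) ^+ 2 <= D.
Proof.
move=> n0; rewrite -[leRHS]sqr_sqrtr// ler_sqr ?nnegrE ?sqrtr_ge0//.
exact: distX.
Qed.

Let step n : (0 < n)%N -> n.+1%:R * b n.+1 <=
  n%:R * b n + dist g (X n.+1) ^+ 2
  - (1 - n.+1%:R^-1) * dist (S n) (X n.+1) ^+ 2.
Proof.
move=> n0.
have := npc (PS n0) (PX (ltn0Sn n)) Pg (inv01 n).
rewrite -SS// -/(b n) -/(b n.+1) => h.
have n1 : 0 < n.+1%:R :> R by rewrite ltr0n.
rewrite -(ler_pM2l n1) in h; apply: le_trans h _.
rewrite le_eqVlt; apply/orP; left; apply/eqP.
rewrite -[n%:R](_ : n.+1%:R - 1 = _); last by rewrite -natr1 addrK.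
by field; rewrite gt_eqF.
Qed.

Let step' n : (0 < n)%N -> n.+1%:R * b n.+1 <= n%:R * b n + D.
Proof.
move=> n0; have := step n0; have := distX2 (ltn0Sn n).
have : 0 <= (1 - n.+1%:R^-1) * dist (S n) (X n.+1) ^+ 2.
  by rewrite mulr_ge0 ?sqr_ge0// subr_ge0; case/andP: (inv01 n).
move: (_ * dist (S n) _ ^+ 2) => *; lra.
Qed.

(** By [step'], [b n.+1] is at most the average of [b n] and [D] with weights [n] and 1. *)
Let b_bounded n : (0 < n)%N -> b n <= D.
Proof.
elim: n => // -[_ _|n /(_ isT) IH _]; first by rewrite /b S1; apply: distX2.
have := step' (ltn0Sn n).
have : n.+1%:R * b n.+1 <= n.+1%:R * D by rewrite ler_wpM2l.
rewrite -[n.+2%:R]natr1 => h1 h2.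
have : (n.+1%:R + 1) * b n.+2 <= (n.+1%:R + 1) * D by lra.
by rewrite ler_pM2l// natr1 ltr0n.
Qed.

Let distSX n l : (0 < n)%N -> (0 < l)%N -> dist (S n) (X l) <= W.
Proof.
move=> n0 l0; have := npc_triangle (PS n0) (PX l0) Pg.
move=> /le_trans -> //; rewrite /W mulr_natl mulr2n lerD ?distX//.
rewrite -(ger0_norm (dist_ge0 _ _)) -sqrtr_sqr ler_wsqrtr//.
exact: b_bounded.
Qed.

Let dist_succ n : (0 < n)%N -> dist (S n) (S n.+1) <= W / n%:R.
Proof.
move=> n0; rewrite SS//.
apply: le_trans (dist_geo (PS n0) (PX (ltn0Sn n)) (inv01 n)) _.
rewrite mulrC ler_pM ?invr_ge0// ?distSX// lef_pV2 ?posrE ?ltr0n//.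
by rewrite ler_nat.
Qed.

Let dist_block q i : (0 < q)%N -> (0 < N)%N ->
  dist (S (q * N)) (S (q * N + i)) <= i%:R * (W / (q * N)%:R).
Proof.
move=> q0 N0; have qN0 : (0 < q * N)%N by rewrite muln_gt0 q0.
elim: i => [|i IH]; first by rewrite addn0 dist_refl ?mul0r//; apply: PS.
have qNi : (0 < q * N + i)%N by rewrite addn_gt0 qN0.
have := npc_triangle (PS qN0) (PS (ltn0Sn (q * N + i))) (PS qNi).
rewrite addnS dist_sym; [|exact: PS|exact: PS].
rewrite (dist_sym (PS (ltn0Sn _))); [|exact: PS].
rewrite (dist_sym (PS qNi) (PS qN0)).
move=> h; apply: le_trans h _; rewrite -natr1 mulrDl mul1r lerD//.
apply: le_trans (dist_succ qNi) _.
by rewrite ler_wpM2l// lef_pV2 ?posrE ?ltr0n// ler_nat leq_addr.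
Qed.

Let block_step q : (0 < q)%N ->
  q.+1%:R * b (q.+1 * N) <= (q%:R - 1) * b (q * N) + 3 * W ^+ 2 / q%:R.
Proof.
move=> q0; have N0 : (0 < N)%N by rewrite Nkm muln_gt0 k0.
have qN0 : (0 < q * N)%N by rewrite muln_gt0 q0.
have qR : 0 < q%:R :> R by rewrite ltr0n.
have NR : 0 < N%:R :> R by rewrite ltr0n.
(* Two of the three units [W ^+ 2 / q%:R] pay for replacing [S n] by [S (q * N)] in a squared
   distance, the third for the weight [1 - n.+1%:R^-1] being replaced by 1. *)
pose E : R := 3 * W ^+ 2 / q%:R.
have one i : (i < N)%N -> (q * N + i).+1%:R * b (q * N + i).+1 <=
    (q * N + i)%:R * b (q * N + i) + dist g (X (q * N + i).+1) ^+ 2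
    - dist (S (q * N)) (X (q * N + i).+1) ^+ 2 + E.
  move=> iN; set n := (q * N + i)%N.
  have n0 : (0 < n)%N by rewrite addn_gt0 qN0.
  apply: le_trans (step n0) _.
  have W2 : 0 <= W ^+ 2 by apply: sqr_ge0.
  have dle : dist (S (q * N)) (S n) <= W / q%:R.
    apply: le_trans (dist_block i q0 N0) _.
    have -> : i%:R * (W / (q * N)%:R) = W / q%:R * (i%:R / N%:R).
      by rewrite natrM; field; rewrite !gt_eqF.
    rewrite ler_piMr ?divr_ge0 ?ler0n// ler_pdivrMr// mul1r.
    by rewrite ler_nat ltnW.
  have tri : dist (S (q * N)) (X n.+1) <= dist (S n) (X n.+1) + W / q%:R.
    have := npc_triangle (PS qN0) (PX (ltn0Sn n)) (PS n0).
    rewrite (dist_sym (PS n0) (PS qN0)); lra.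
  have := distSX n0 (ltn0Sn n); have := distSX qN0 (ltn0Sn n).
  have := dist_ge0 (S n) (X n.+1); have := dist_ge0 (S (q * N)) (X n.+1).
  move: tri; set p := dist (S n) _; set r := dist (S (q * N)) _.
  set e := W / q%:R => tri r0 p0 rW pW.
  have r01 : 0 <= r <= W by rewrite r0.
  have p01 : 0 <= p <= W by rewrite p0.
  have e0 : 0 <= e by rewrite divr_ge0// ltW.
  have rp : r ^+ 2 - p ^+ 2 <= 2 * W * e by apply: sub_sqr_le.
  have pn : n.+1%:R^-1 * p ^+ 2 <= e * W.
    rewrite /e mulrAC -expr2 mulrC ler_pM ?invr_ge0 ?sqr_ge0 ?ler0n//.
      by rewrite ler_sqr ?nnegrE.
    rewrite lef_pV2 ?posrE ?ltr0n// ler_nat ltnW// ltnS.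
    by rewrite (leq_trans _ (leq_addr _ _))// leq_pmulr.
  have -> : E = 3 * (W * e) by rewrite /E /e; ring.
  move: rp pn; rewrite mulrBl mul1r [e * W]mulrC -mulrA.
  set u := _^-1 * p ^+ 2; set v := W * e; set z := n%:R * b n + _.
  clearbody u v z; lra.
have tel j : (j <= N)%N -> (q * N + j)%:R * b (q * N + j) <=
    (q * N)%:R * b (q * N) + \sum_(i < j) (dist g (X (q * N + i).+1) ^+ 2
    - dist (S (q * N)) (X (q * N + i).+1) ^+ 2 + E).
  elim: j => [_|j IH jN]; first by rewrite addn0 big_ord0 addr0.
  rewrite big_ord_recr/= addnS; apply: le_trans (one _ jN) _.
  have := IH (ltnW jN); lra.
have := tel N (leqnn N); rewrite -mulSnr.
rewrite big_split/= sumrB sumr_const card_ord -mulr_natl.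
rewrite (X_block (fun c => dist g c ^+ 2)) (X_block (fun c => dist (S (q * N)) c ^+ 2)).
have swap c : P c -> \sum_(j < m) dist c (a j) ^+ 2 = cost c.
  by move=> Pc; apply: eq_bigr => j _; rewrite dist_sym.
rewrite !swap//; last exact: PS.
(* Multiplied by [k], the variance inequality gains [N%:R * b (q * N)] over the block, which lowers
   the coefficient from [q] to [q - 1]. *)
have := variance_ineq Pg gmin (PS qN0); rewrite -/(b _).
have kR : 0 <= k%:R :> R by rewrite ler0n.
move=> /(ler_wpM2l kR); rewrite mulrA -natrM -Nkm !natrM => v h.
rewrite -(ler_pM2l NR) -/E; lra.
Qed.

Lemma inductive_mean_rate : exists2 L : R, 0 < L &
  forall n, (0 < n)%N -> dist (S n) g ^+ 2 <= L / n%:R.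
Proof.
have N0 : (0 < N)%N by rewrite Nkm muln_gt0 k0.
pose C := 3 * W ^+ 2.
have C0 : 0 <= C by rewrite mulr_ge0// sqr_ge0.
(* The bound propagates because q (q + 1) b_((q+1)N) <= (q - 1) (C + D) + C <= q (C + D). The
   summand [D] covers the first block, to which [block_step] does not apply. *)
have blocks q : q%:R * b (q * N) <= C + D.
  elim: q => [|q]; first by rewrite mul0r addr_ge0.
  have [->|q0] := posnP q.
    by rewrite mul1r mul1n => _; rewrite ler_wpDl// b_bounded.
  move=> IH; apply: le_trans (block_step q0) _.
  have qR : 0 < q%:R :> R by rewrite ltr0n.
  have q1 : 1 <= q%:R :> R by rewrite ler1n.
  rewrite -/C -(ler_pM2l qR) mulrDr mulrCA [q%:R * (C / _)]mulrC.
  rewrite divfK ?gt_eqF//.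
  have q10 : 0 <= q%:R - 1 :> R by rewrite subr_ge0.
  apply: le_trans (lerD (ler_wpM2l q10 IH) (lexx C)) _.
  by rewrite mulrBl mul1r -addrA gerDl addrC subr_le0 lerDl.
(* The crude recursion suffices inside an incomplete block, which has fewer than [N] steps. *)
have tel i j : (j%:R + i%:R) * b (j + i)%N <= j%:R * b j + i%:R * D.
  elim: i => [|i]; first by rewrite addn0 mul0r !addr0.
  rewrite -!natrD addnS.
  have [ji|ji] := posnP (j + i)%N.
    move: ji => /eqP; rewrite addn_eq0 => /andP[/eqP -> /eqP ->] _.
    by rewrite !mul1r mul0r add0r b_bounded.
  move=> IH; apply: le_trans (step' ji) _; rewrite -natr1; lra.
(* The first term comes from the complete blocks, the second from the [n %% N] remaining steps; the
   final 1 makes the constant positive. *)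
exists (N%:R * (C + D) + N%:R * D + 1).
  by rewrite ltr_wpDl// addr_ge0// mulr_ge0// addr_ge0.
move=> n n0; rewrite dist_sym//; last exact: PS.
have nR : 0 < n%:R :> R by rewrite ltr0n.
rewrite ler_pdivlMr// mulrC -/(b n).
have := tel (n %% N)%N (n %/ N * N)%N; rewrite -natrD -divn_eq.
move=> /le_trans -> //; rewrite -addrA lerD//.
  by rewrite natrM mulrAC mulrC ler_wpM2l ?ler0n.
rewrite ler_wpDr// ler_wpM2r// ler_nat ltnW// ltn_mod//.
Qed.

End Barycenter.
End Hadamard.

(** * Sums of squared logarithms *)

Section LogSquares.
Variable R : realType.
Implicit Types (x y u v h e : R) (n : nat).

Lemma le_is_derive_norm (f df : R -> R) (a b e : R) :
  (forall u, is_derive u (1 : R) f (df u)) ->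
  (forall u, Num.min a b <= u <= Num.max a b -> `|df u| <= e) ->
  `|f b - f a| <= e * `|b - a|.
Proof.
move=> fdf dfe.
wlog ab : a b dfe / a <= b.
  move=> H; have [/H|/ltW ba] := leP a b; first exact.
  by rewrite distrC [`|b - a|]distrC; apply: H => //; rewrite minC maxC.
have cf : {within `[a, b]%classic, continuous f}%classic.
  apply: continuous_subspaceT => u; apply: differentiable_continuous.
  by apply/derivable1_diffP; case: (fdf u).
have [c] := @MVT_segment _ f df a b ab (fun u _ => fdf u) cf.
rewrite in_itv/= => /andP[ac cb] ->; rewrite normrM ler_wpM2r//.
by apply: dfe; rewrite min_l// max_r// ac.
Qed.

Lemma le_is_derive (f df : R -> R) (a b : R) : a <= b ->
  (forall u, is_derive u (1 : R) f (df u)) ->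
  (forall u, a <= u <= b -> 0 <= df u) -> f a <= f b.
Proof.
move=> ab fdf df0.
have cf : {within `[a, b]%classic, continuous f}%classic.
  apply: continuous_subspaceT => u; apply: differentiable_continuous.
  by apply/derivable1_diffP; case: (fdf u).
have [c] := @MVT_segment _ f df a b ab (fun u _ => fdf u) cf.
rewrite in_itv/= => /df0 dc fba.
by rewrite -subr_ge0 fba mulr_ge0// subr_ge0.
Qed.

Lemma expR_sub_ge u : 0 <= u -> 2 * u <= expR u - expR (- u).
Proof.
move=> u0; rewrite -subr_ge0.
pose f := fun v : R => expR v - expR (- v) - 2 * v.
have -> : 0 = f 0 by rewrite /f oppr0 subrr mulr0 subrr.
apply: (@le_is_derive f (fun v => expR v + expR (- v) - 2)) => //.
  move=> v; rewrite /f.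
  apply: is_derive_eq; rewrite /GRing.scale/=; ring.
move=> v _; have e0 := expR_gt0 v; rewrite expRN.
have -> : expR v + (expR v)^-1 - 2 = (expR v - 1) ^+ 2 / expR v.
  by field; rewrite gt_eqF.
by rewrite divr_ge0 ?sqr_ge0 ?ltW.
Qed.

(** For x = e^(2u) the right-hand side is (e^u - e^(-u))^2, and the claim is the square of
    [expR_sub_ge]. *)
Lemma ln_sqr_le x : 0 < x -> ln x ^+ 2 <= x + x^-1 - 2.
Proof.
move=> x0; wlog x1 : x x0 / 1 <= x.
  move=> H; have [/H|/ltW x1] := leP 1 x; first exact.
  have := H x^-1; rewrite invr_gt0 invf_ge1// lnV ?posrE// sqrrN invrK.
  by rewrite [x^-1 + x]addrC; apply.
have l0 : 0 <= ln x / 2 by rewrite divr_ge0// ln_ge0.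
have := expR_sub_ge l0; set u := ln x / 2 => hu.
have xE : x = expR u ^+ 2 by rewrite -expRM_natl /u mulrC divfK// lnK.
have -> : x + x^-1 - 2 = (expR u - expR (- u)) ^+ 2.
  by rewrite xE expRN; field; rewrite gt_eqF// expR_gt0.
have -> : ln x = 2 * u by rewrite /u; field.
have u2 : 0 <= 2 * u by rewrite mulr_ge0.
by rewrite ler_sqr ?nnegrE// (le_trans u2).
Qed.

(** Only even powers of t = x - 1 occur, so that summing over eigenvalues produces traces of powers
    of a matrix. The proof bounds ln^2 x below by t^2 (1 - 2 max(0, t)) and splits the cubic term by
    2 t <= e + t^2 / e. *)
Lemma ln_sqr_ge x e : 0 < x -> 0 < e ->
  (1 - e) * (x - 1) ^+ 2 - (x - 1) ^+ 4 / e <= ln x ^+ 2.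
Proof.
move=> x0 e0; set t := x - 1.
have t4 : 0 <= t ^+ 4 / e by rewrite divr_ge0 ?exprn_even_ge0// ltW.
have lower : t ^+ 2 * (1 - 2 * Num.max 0 t) <= ln x ^+ 2.
  have [x1|/ltW x1] := leP x 1.
    have tn : t <= 0 by rewrite subr_le0.
    rewrite max_l// mulr0 subr0 mulr1.
    have lt : ln x <= t by have := @le_ln1Dx _ t; rewrite /t subrKC; apply; lra.
    by rewrite -sqrrN -[leRHS]sqrrN ler_sqr ?nnegrE ?oppr_ge0 ?lerN2// (le_trans lt).
  have t0 : 0 <= t by rewrite subr_ge0.
  rewrite max_r//.
  have lt : t / x <= ln x.
    have := @le_ln1Dx _ (x^-1 - 1); rewrite subrKC lnV ?posrE// => h.
    have : - ln x <= x^-1 - 1 by apply: h; have := invr_gt0 x; rewrite x0; lra.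
    have -> : t / x = 1 - x^-1 by rewrite /t; field; rewrite gt_eqF.
    lra.
  have tx0 : 0 <= t / x by rewrite divr_ge0// ltW.
  have : (t / x) ^+ 2 <= ln x ^+ 2 by rewrite ler_sqr ?nnegrE// (le_trans tx0).
  apply: le_trans; rewrite expr_div_n ler_pdivlMr ?exprn_gt0//.
  rewrite -mulrA ler_piMr ?sqr_ge0//.
  have -> : x = 1 + t by rewrite /t subrKC.
  have -> : (1 - 2 * t) * (1 + t) ^+ 2 = 1 - t ^+ 2 * (3 + 2 * t) by ring.
  by rewrite gerBl mulr_ge0 ?sqr_ge0// addr_ge0// mulr_ge0.
apply: le_trans lower.
have -> : (1 - e) * t ^+ 2 - t ^+ 4 / e = t ^+ 2 * (1 - (e + t ^+ 2 / e)).
  by field; rewrite gt_eqF.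
rewrite ler_wpM2l ?sqr_ge0// lerB// -subr_ge0.
have [t0|t0] := leP t 0.
  by rewrite mulr0 subr0 addr_ge0 ?(ltW e0)// divr_ge0 ?sqr_ge0 ?(ltW e0).
have -> : e + t ^+ 2 / e - 2 * t = (e - t) ^+ 2 / e by field; rewrite gt_eqF.
by rewrite divr_ge0 ?sqr_ge0 ?(ltW e0).
Qed.

Definition softplus u := ln (1 + expR u).
Definition logistic u := expR u / (1 + expR u).

Let expR1_gt0 u : 0 < 1 + expR u.
Proof. by rewrite addr_gt0// expR_gt0. Qed.

Lemma is_derive_softplus u : is_derive u (1 : R) softplus (logistic u).
Proof.
have h : is_derive u (1 : R) (fun v : R => 1 + expR v) (expR u).
  by apply: is_derive_eq; rewrite add0r mul1r.
have := @is_derive1_comp _ (@ln R) (fun v : R => 1 + expR v) u _ _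
  (is_derive1_ln (expR1_gt0 u)) h.
by rewrite mulrC.
Qed.

Lemma logistic_homo : {homo logistic : u v / u <= v}.
Proof.
move=> u v uv; rewrite /logistic ler_pdivrMr// mulrAC ler_pdivlMr//.
by rewrite !mulrDr !mulr1 [expR u * expR v]mulrC lerD2r ler_expR.
Qed.

Lemma logistic01 u : 0 <= logistic u <= 1.
Proof.
rewrite /logistic ler_pdivrMr// mul1r lerDr ler01 andbT.
by rewrite divr_ge0// ?expR_ge0// ltW.
Qed.

Lemma softplus_ge0 u : 0 <= softplus u.
Proof. by rewrite ln_ge0// lerDl expR_ge0. Qed.

Lemma softplus_le u : softplus u <= expR u.
Proof. by rewrite le_ln1Dx// (lt_trans _ (expR_gt0 u))// ltrN10. Qed.

Lemma softplusN u : softplus u = u + softplus (- u).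
Proof.
rewrite /softplus; have -> : 1 + expR u = expR u * (1 + expR (- u)).
  by rewrite mulrDr mulr1 -expRD subrr expR0 addrC.
by rewrite lnM ?posrE ?expR_gt0// expRK.
Qed.

Lemma softplus_diff u h : 0 <= h ->
  h * logistic u <= softplus (u + h) - softplus u <= h * logistic (u + h).
Proof.
move=> h0.
have cf : {within `[u, u + h]%classic, continuous softplus}%classic.
  apply: continuous_subspaceT => v; apply: differentiable_continuous.
  by apply/derivable1_diffP; case: (is_derive_softplus v).
have uh : u <= u + h by rewrite lerDl.
have [c] := @MVT_segment _ softplus logistic u (u + h) uh
  (fun v _ => is_derive_softplus v) cf.
rewrite in_itv/= => /andP[uc cuh] ->.
by rewrite addrAC subrr add0r ![_ * h]mulrC !ler_wpM2l// logistic_homo.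
Qed.

(** [logistic] is the derivative of [softplus]; being increasing with values in [0, 1], it differs
    from its left Riemann sums by at most one mesh width after integration. *)
Lemma riemann_logistic u h N : 0 <= h ->
  `| \sum_(k < N) h * logistic (u + k%:R * h)
    - (softplus (u + N%:R * h) - softplus u) | <= h.
Proof.
move=> h0.
have [lo hi] :
    \sum_(k < N) h * logistic (u + k%:R * h) <=
      softplus (u + N%:R * h) - softplus u /\
    softplus (u + N%:R * h) - softplus u <=
      \sum_(k < N) h * logistic (u + k%:R * h)
      + h * (logistic (u + N%:R * h) - logistic u).
  elim: N => [|N [lo hi]]; first by rewrite big_ord0 mul0r addr0 !subrr mulr0 addr0.
  rewrite big_ord_recr/=.
  have := softplus_diff (u + N%:R * h) h0.
  have -> : u + N%:R * h + h = u + N.+1%:R * h by rewrite -natr1; ring.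
  move=> /andP[l r].
  split; lra.
have /andP[l0 _] := logistic01 u.
have /andP[_ l1] := logistic01 (u + N%:R * h).
rewrite ler_norml; apply/andP; split; last lra.
have : h * (logistic (u + N%:R * h) - logistic u) <= h by rewrite ler_piMr//; lra.
lra.
Qed.

(* Riemann sums of the integral over [-n, n] of s |-> ln (1 + exp (u + s)),
   whose second derivative in u is nearly 1. *)
Definition log_mixture n u :=
  \sum_(k < 2 * n * n) n%:R^-1 * softplus (u - n%:R + k%:R / n%:R).

(** The derivative of [log_mixture n] at v is a Riemann sum for softplus(v + n) - softplus(v - n),
    with error at most 1/n. By [softplusN] this difference is v + n up to two terms of size at most
    e^(M - n) <= e^M / n, whence the factor [1 + 2 * expR M]; integrating from 0 to [u] gives the
    factor [M]. *)
Lemma log_mixture_sqr (M : R) : exists2 C : R, 0 <= C & forall n u, (0 < n)%N ->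
  `|u| <= M ->
  `|log_mixture n u - (log_mixture n 0 + n%:R * u + u ^+ 2 / 2)| <= C / n%:R.
Proof.
have [M0|M0] := ltP M 0.
  by exists 0 => // n u _ /le_lt_trans/(_ M0); rewrite normr_lt0.
have C0 : 0 <= (1 + 2 * expR M) by rewrite addr_ge0 ?mulr_ge0// expR_ge0.
exists ((1 + 2 * expR M) * M); first by rewrite mulr_ge0.
move=> n u n0 uM; have nR : 0 < n%:R :> R by rewrite ltr0n.
pose f v := log_mixture n v - n%:R * v - v ^+ 2 / 2.
pose s v := \sum_(k < 2 * n * n) n%:R^-1 * logistic (v - n%:R + k%:R * n%:R^-1).
have der v : is_derive v (1 : R) f (s v - n%:R - v).
  have dm : is_derive v (1 : R) (log_mixture n) (s v).
    rewrite (_ : log_mixture n = \sum_(k < 2 * n * n)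
        (fun v => n%:R^-1 * softplus (v - n%:R + k%:R / n%:R))); last first.
      by apply/funext => w; rewrite /log_mixture fct_sumE.
    apply: is_derive_sum => k.
    have h : is_derive v (1 : R) (fun v : R => v - n%:R + k%:R / n%:R) 1.
      by apply: is_derive_eq; rewrite subr0 addr0.
    have := is_derive1_comp (is_derive_softplus _) h.
    rewrite mulr1 => h2.
    by apply: is_derive_eq.
  rewrite /f; apply: is_derive_eq.
  by rewrite /GRing.scale/=; field.
have sb v : `|v| <= M -> `|s v - n%:R - v| <= (1 + 2 * expR M) / n%:R.
  move=> vM; have := @riemann_logistic (v - n%:R) n%:R^-1 (2 * n * n).
  rewrite invr_ge0 ler0n => /(_ isT); rewrite -/(s v).
  have -> : v - n%:R + (2 * n * n)%:R / n%:R = v + n%:R.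
    by rewrite !natrM mulfK ?gt_eqF//; ring.
  rewrite [softplus (v + _)]softplusN => h.
  have en : expR (- n%:R) <= n%:R^-1 :> R.
    rewrite expRN lef_pV2 ?posrE ?expR_gt0//.
    by have := expR_ge1Dx (n%:R : R); lra.
  have bnd w : w <= M - n%:R -> softplus w <= expR M / n%:R.
    move=> wM; apply: le_trans (softplus_le _) _.
    apply: (@le_trans _ _ (expR (M - n%:R))); first by rewrite ler_expR.
    by rewrite expRD ler_wpM2l ?expR_ge0.
  move: vM; rewrite ler_norml => /andP[vM1 vM2].
  have b1 := softplus_ge0 (- (v + n%:R)); have b2 := softplus_ge0 (v - n%:R).
  have b3 : softplus (- (v + n%:R)) <= expR M / n%:R by apply: bnd; lra.
  have b4 : softplus (v - n%:R) <= expR M / n%:R by apply: bnd; lra.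
  have -> : (1 + 2 * expR M) / n%:R = n%:R^-1 + 2 * (expR M / n%:R) by ring.
  move: h; rewrite !ler_norml => /andP[h1 h2].
  move: (expR M / _) b3 b4 => E b3 b4.
  apply/andP; split; lra.
have := @le_is_derive_norm f _ 0 u ((1 + 2 * expR M) / n%:R) der.
have -> : log_mixture n u - (log_mixture n 0 + n%:R * u + u ^+ 2 / 2) = f u - f 0.
  by rewrite /f mulr0 expr0n/= mul0r !subr0 !opprD !addrA; ring.
move=> H; apply: le_trans (H _) _.
  move=> v vu; apply: sb; move: uM vu.
  rewrite !ler_norml => /andP[h1 h2] /andP[h3 h4].
  rewrite (le_trans _ h3) ?(le_trans h4)//.
    by rewrite ge_max M0.
  by rewrite le_min h1 oppr_le0 M0.
by rewrite subr0 -[leRHS]mulrAC ler_wpM2l// divr_ge0// ltW.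
Qed.

Lemma ln_prod (d : nat) (f : 'I_d -> R) : (forall i, 0 < f i) ->
  ln (\prod_i f i) = \sum_i ln (f i).
Proof.
move=> f0.
suff [_ //] : 0 < \prod_i f i /\ ln (\prod_i f i) = \sum_i ln (f i).
apply: (big_ind2 (fun x y => 0 < x /\ ln x = y)).
- by rewrite ltr01 ln1.
- by move=> x1 x2 y1 y2 [? <-] [? <-]; rewrite mulr_gt0// lnM.
- by move=> i _.
Qed.

(* Integrated over s = ln c, the hypothesis compares the sums of ln^2, because
   u^2 / 2 is, up to an affine function, the integral over s of ln (1 + e^(u+s)). *)
Lemma sum_ln_sqr_le (d : nat) (x y : 'I_d -> R) :
  (forall i, 0 < x i) -> (forall i, 0 < y i) ->
  (forall c : R, 0 < c -> \prod_i (1 + c * y i) <= \prod_i (1 + c * x i)) ->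
  \prod_i y i = \prod_i x i ->
  \sum_i ln (y i) ^+ 2 <= \sum_i ln (x i) ^+ 2.
Proof.
move=> x0 y0 xy1 xy.
pose M : R := \sum_i (`|ln (x i)| + `|ln (y i)|).
have Mi i : `|ln (x i)| + `|ln (y i)| <= M.
  by rewrite /M (bigD1 i)//= lerDl sumr_ge0// => j _; rewrite addr_ge0.
have xM i : `|ln (x i)| <= M by apply: le_trans (Mi i); rewrite lerDl.
have yM i : `|ln (y i)| <= M by apply: le_trans (Mi i); rewrite lerDr.
have [C C0 hC] := log_mixture_sqr M.
have mix n : (0 < n)%N ->
    \sum_i log_mixture n (ln (y i)) <= \sum_i log_mixture n (ln (x i)).
  move=> n0; rewrite /log_mixture exchange_big [leRHS]exchange_big/=.
  apply: ler_sum => k _; rewrite -!mulr_sumr ler_wpM2l ?invr_ge0//.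
  set s := k%:R / n%:R.
  (* Each summand is the logarithm of one determinant-like product, taken at c = e^(s - n). *)
  have E (z : 'I_d -> R) : (forall i, 0 < z i) ->
      \sum_i softplus (ln (z i) - n%:R + s) =
      ln (\prod_i (1 + expR (s - n%:R) * z i)).
    move=> z0; rewrite ln_prod.
      apply: eq_bigr => i _; congr (ln (1 + _)).
      rewrite -[in RHS](@lnK _ (z i)) ?posrE//.
      by rewrite -expRD; congr expR; ring.
    by move=> i; rewrite addr_gt0// mulr_gt0// expR_gt0.
  rewrite !E//; have p0 (z : 'I_d -> R) : (forall i, 0 < z i) ->
      0 < \prod_i (1 + expR (s - n%:R) * z i).
    by move=> z0; apply: prodr_gt0 => i _; rewrite addr_gt0// mulr_gt0// expR_gt0.
  by rewrite ler_ln ?posrE ?p0// xy1// expR_gt0.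
(* Equality of the products cancels the terms [n%:R * ln _], which would otherwise grow with [n]. *)
have lnE : \sum_i ln (y i) = \sum_i ln (x i) by rewrite -!ln_prod// xy.
have key n : (0 < n)%N ->
    \sum_i ln (y i) ^+ 2 / 2 <= \sum_i ln (x i) ^+ 2 / 2 + 2 * d%:R * C / n%:R.
  move=> n0; have cst (c : R) : \sum_(i < d) c = d%:R * c.
    by rewrite sumr_const card_ord mulr_natl.
  have hy : \sum_i (log_mixture n 0 + n%:R * ln (y i) + ln (y i) ^+ 2 / 2) <=
      \sum_i (log_mixture n (ln (y i)) + C / n%:R).
    apply: ler_sum => i _; have := hC n _ n0 (yM i).
    rewrite ler_norml => /andP[h _]; lra.
  have hx : \sum_i log_mixture n (ln (x i)) <=
      \sum_i (log_mixture n 0 + n%:R * ln (x i) + ln (x i) ^+ 2 / 2 + C / n%:R).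
    apply: ler_sum => i _; have := hC n _ n0 (xM i).
    rewrite ler_norml => /andP[_ h]; lra.
  move: hx hy; rewrite !big_split/= -!mulr_sumr lnE !cst.
  have := mix n n0; have -> : 2 * d%:R * C / n%:R = 2 * (C * (d%:R / n%:R)) by ring.
  move: (C * (d%:R / _)) (d%:R * log_mixture _ _) => E F.
  move: (\sum_i log_mixture n (ln (x i))) (\sum_i log_mixture n (ln (y i))).
  move=> a b; rewrite -!mulr_suml.
  lra.
have : \sum_i ln (y i) ^+ 2 / 2 <= \sum_i ln (x i) ^+ 2 / 2; last first.
  by rewrite -!mulr_suml ler_pM2r ?invr_gt0.
apply/ler_addgt0Pr => e e0.
pose n := (Num.truncn (2 * d%:R * C / e)).+1.
apply: le_trans (key n isT) _; rewrite lerD2l ler_pdivrMr ?ltr0n//.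
rewrite [e * _]mulrC -ler_pdivrMr//; apply/ltW; exact: truncnS_gt.
Qed.

End LogSquares.

(** * Integrals over intervals and difference quotients *)

Section Intervals.
Local Open Scope classical_set_scope.
Variable R : realType.
Implicit Types (a b c s t : R) (h k : R -> R).
Notation mu := (@lebesgue_measure R).

(** Compactness of the segment as an induction principle: a relation that can be concatenated and
    holds on all short subintervals around each point holds on the whole segment. The proof shows
    that the supremum of the points reachable from [a] is [b]. *)
Lemma interval_induction (P : R -> R -> Prop) a b : a <= b ->
  (forall s m t, a <= s -> s <= m -> m <= t -> t <= b ->
     P s m -> P m t -> P s t) ->
  (forall t, a <= t <= b -> exists2 e, 0 < e & forall s u,
     a <= s -> s <= u -> u <= b -> `|s - t| < e -> `|u - t| < e -> P s u) ->
  P a b.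
Proof.
move=> ab Pcat Ploc.
pose S := [set x | a <= x <= b /\ P a x].
have Sa : S a.
  have [|e e0 h] := Ploc a; first by rewrite lexx.
  by split; [rewrite lexx|apply: h => //; rewrite subrr normr0].
have supS : has_sup S by split; [exists a|exists b => x [/andP[]]].
have St : a <= sup S <= b.
  by rewrite ub_le_sup//=; [apply: ge_sup; [exists a|move=> x [/andP[]]]|case: supS].
set t := sup S in St.
have [e e0 loc] := Ploc t St; case/andP: (St) => a_t t_b.
have [x Sx tx] := sup_adherent e0 supS; have [/andP[ax xb] Pax] := Sx.
have xt : x <= t by apply: ub_le_sup => //; case: supS.
pose y := Num.min b (t + e / 2).
have ty : t <= y by rewrite le_min t_b lerDl divr_ge0// ltW.
have yb : y <= b by rewrite ge_min lexx.
have yte : y <= t + e / 2 by rewrite ge_min lexx orbT.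
have Py : P a y.
  apply: (Pcat a x y) => //; first exact: le_trans xt ty.
  apply: loc => //; first exact: le_trans xt ty.
    by rewrite ltr_norml; apply/andP; rewrite -/t in tx; split; lra.
  by rewrite ltr_norml; apply/andP; split; lra.
have yt : y <= t.
  apply: ub_le_sup; first by case: supS.
  by split=> //; rewrite yb (le_trans a_t).
suff <- : y = b by [].
apply/eqP; rewrite eq_le yb/=; move: yt; rewrite /y ge_min => /orP[bt|]; last by lra.
by rewrite le_min lexx/=; lra.
Qed.

Definition int h a b : \bar R := (\int[mu]_(x in `[a, b]) (h x)%:E)%E.

Lemma int_ge0 h a b : (forall x, 0 <= h x) -> (0 <= int h a b)%E.
Proof. by move=> h0; apply: integral_ge0 => x _; rewrite lee_fin. Qed.

Lemma int_oo h a b : measurable_fun `]a, b[ h ->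
  int h a b = (\int[mu]_(x in `]a, b[) (h x)%:E)%E.
Proof.
move=> mh; rewrite integral_itv_bndo_bndc; last exact/measurable_EFinP.
have mh' : measurable_fun `]a, b] h by apply/measurable_fun_itv_bndo_bndcP.
by rewrite integral_itv_obnd_cbnd//; exact/measurable_EFinP.
Qed.

(** Agreement is asked only inside the interval because nothing is known about the derivative of a
    piecewise smooth path at its break points. *)
Lemma eq_int_oo h k a b : measurable_fun `]a, b[ k ->
  {in `]a, b[%R, h =1 k} ->
  measurable_fun `[a, b] h /\ int h a b = int k a b.
Proof.
move=> mk hk; have mh : measurable_fun `]a, b[ h.
  apply: eq_measurable_fun mk => x; rewrite inE/= => xab; exact/esym/hk.
split; first exact: measurable_fun_itv_cc mh.
rewrite !int_oo//; apply: eq_integral => x; rewrite inE/= => xab; congr EFin; exact: hk.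
Qed.

Lemma int_cat h a c b : (forall x, 0 <= h x) -> a <= c -> c <= b ->
  measurable_fun `[a, c] h -> measurable_fun `[c, b] h ->
  measurable_fun `[a, b] h /\ int h a b = (int h a c + int h c b)%E.
Proof.
move=> h0 ac cb mh1 mh2.
have mh2' : measurable_fun `]c, b] h by apply/measurable_fun_itv_obnd_cbndP.
have E : `[a, b] = `[a, c] `|` `]c, b].
  by rewrite -itv_bndbnd_setU// bnd_simp.
have mh : measurable_fun `[a, b] h by rewrite E; apply/measurable_funU.
split=> //; rewrite /int E ge0_integral_setU//.
- by congr (_ + _)%E; rewrite integral_itv_obnd_cbnd//; exact/measurable_EFinP.
- by rewrite -E; exact/measurable_EFinP.
- by move=> x _; rewrite lee_fin.
- rewrite disj_set2E; apply/eqP/seteqP; split=> // x /=.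
  rewrite !in_itv/= => -[/andP[_ xc] /andP[cx _]].
  by move: (lt_le_trans cx xc); rewrite ltxx.
Qed.

Lemma int_cst_le h a b c : (forall x, 0 <= h x) -> a <= b ->
  measurable_fun `[a, b] h -> {in `[a, b]%R, forall x, c <= h x} ->
  ((c * (b - a))%:E <= int h a b)%E.
Proof.
move=> h0 ab mh ch.
have [c0|c0] := leP c 0.
  apply: (@le_trans _ _ 0%E); last exact: int_ge0.
  by rewrite lee_fin mulr_le0_ge0// subr_ge0.
have -> : (c * (b - a))%:E = (\int[mu]_(x in `[a, b]) (cst c%:E x))%E.
  rewrite integral_cst//= lebesgue_measure_itv/= lte_fin.
  have [_|ba] := ltP a b; first by rewrite -EFinD EFinM.
  by have -> : a = b by [apply/eqP; rewrite eq_le ab]; rewrite subrr mulr0 mule0.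
apply: ge0_le_integral => //.
- by move=> x _; rewrite lee_fin ltW.
- exact/measurable_EFinP.
Qed.

Lemma within_int_fin h a b : {within `[a, b], continuous h} ->
  measurable_fun `[a, b] h /\ (int h a b < +oo)%E.
Proof.
move=> ch; have ih : mu.-integrable `[a, b] (EFin \o h).
  by apply: continuous_compact_integrable => //; apply: segment_compact.
split; first by apply/measurable_EFinP; case/integrableP: ih.
apply: le_lt_trans (lee_abs _) _; rewrite -fin_num_abs.
exact: integrable_fin_num.
Qed.

Lemma fine_int_cat h a c b : (forall x, 0 <= h x) -> a <= c -> c <= b ->
  {within `[a, b], continuous h} ->
  fine (int h a b) = fine (int h a c) + fine (int h c b).
Proof.
move=> h0 ac cb ch.
have ch1 : {within `[a, c], continuous h}.
  by apply: continuous_subspaceW ch; apply: subset_itvl; rewrite bnd_simp.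
have ch2 : {within `[c, b], continuous h}.
  by apply: continuous_subspaceW ch; apply: subset_itvr; rewrite bnd_simp.
have [m1 f1] := within_int_fin ch1; have [m2 f2] := within_int_fin ch2.
have [_ ->] := int_cat h0 ac cb m1 m2.
by rewrite fineD// ge0_fin_numE// int_ge0.
Qed.

(** Both end points of a short interval tend to [t] independently, as [interval_induction] requires;
    convergence of slopes along this filter is strict differentiability relative to the segment. *)
Definition increasing_pairs a b t : set_system (R * R) :=
  within [set p | [/\ p.1 \in `[a, b]%R, p.2 \in `[a, b]%R & p.1 < p.2]] (nbhs (t, t)).

Global Instance increasing_pairs_filter a b t : Filter (increasing_pairs a b t).
Proof. exact: within_filter. Qed.

Lemma cvg_increasing_pairs1 a b t (f : R -> R) : {for t, continuous f} ->
  (fun p : R * R => f p.1) @ increasing_pairs a b t --> f t.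
Proof.
move=> cf; apply: cvg_within_filter.
apply: (@cvg_comp _ _ _ fst f _ (nbhs t)) => //.
exact: cvg_fst.
Qed.

Lemma cvg_increasing_pairs2 a b t (f : R -> R) : {for t, continuous f} ->
  (fun p : R * R => f p.2) @ increasing_pairs a b t --> f t.
Proof.
move=> cf; apply: cvg_within_filter.
apply: (@cvg_comp _ _ _ snd f _ (nbhs t)) => //.
exact: cvg_snd.
Qed.

(** The mean value theorem is applied to v |-> f v - f'(t) v, whose derivative is small near [t] by
    continuity of f'. *)
Lemma cvg_slope a b t (f : R -> R) :
  (forall x, derivable f x 1) -> {for t, continuous (derive1 f)} ->
  (fun p : R * R => (p.2 - p.1)^-1 * (f p.2 - f p.1)) @ increasing_pairs a b t
    --> derive1 f t.
Proof.
move=> df cf; apply/cvgrPdist_le => e e0.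
have /cvgrPdist_le/(_ _ e0)/nbhs_ballP[r /= r0 hr] := cf.
have der u : is_derive u (1 : R) (fun v => f v - derive1 f t * v)
    (derive1 f u - derive1 f t).
  have h : is_derive u (1 : R) f (derive1 f u).
    by rewrite derive1E; apply: DeriveDef.
  apply: is_derive_eq; rewrite /GRing.scale/=; ring.
rewrite /increasing_pairs near_withinE; apply/nbhs_ballP; exists r => // -[s u].
move=> -[/= ts tu] [_ _ su].
have us0 : 0 < u - s by rewrite subr_gt0.
have := @le_is_derive_norm _ _ _ s u e der.
rewrite min_l ?(ltW su)// max_r ?(ltW su)// => H.
have -> : derive1 f t - (u - s)^-1 * (f u - f s) =
   - ((u - s)^-1 * ((f u - derive1 f t * u) - (f s - derive1 f t * s))).
  by field; rewrite gt_eqF.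
rewrite normrN normrM ger0_norm ?invr_ge0 ?(ltW us0)//.
rewrite mulrC ler_pdivrMr//; apply: (le_trans (H _)); last first.
  by rewrite ger0_norm// ltW.
move=> v /andP[sv vu]; rewrite distrC; apply: hr; rewrite -ball_normE/=.
move: ts tu; rewrite -!ball_normE/= !ltr_norml => /andP[h1 h2] /andP[h3 h4].
by apply/andP; split; lra.
Qed.

End Intervals.

(** * Positive definite matrices *)

Section RealDiagonal.
Local Open Scope sesquilinear_scope.
Local Open Scope complex_scope.
Variable R : realType.
Local Notation C := R[i].

Lemma conjC_real (x : R) : Num.conj (x%:C : C) = x%:C.
Proof. exact: conjc_real. Qed.

Lemma ctmxM m n p (A : 'M[C]_(m, n)) (B : 'M[C]_(n, p)) :
  (A *m B)^t* = B^t* *m A^t*.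
Proof. by rewrite trmx_mul map_mxM. Qed.

Lemma ctmxV n (A : 'M[C]_n) : (invmx A)^t* = invmx (A^t*).
Proof. by rewrite trmx_inv map_invmx. Qed.

Lemma ctmx_unit n (A : 'M[C]_n) : (A^t* \in unitmx) = (A \in unitmx).
Proof. by rewrite map_unitmx unitmx_tr. Qed.

Lemma invmxM n (A B : 'M[C]_n) : A \in unitmx -> B \in unitmx ->
  invmx (A *m B) = invmx B *m invmx A.
Proof.
move=> Au Bu; have ABu : A *m B \in unitmx by rewrite unitmx_mul Au.
rewrite -[RHS](mulKmx ABu) -!mulmxA (mulmxA B) (mulmxV Bu) mul1mx.
by rewrite (mulmxV Au) mulmx1.
Qed.

Lemma det_ctmx n (A : 'M[C]_n) : \det (A^t*) = Num.conj (\det A).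
Proof. by rewrite det_map_mx det_tr. Qed.

Lemma hermsymmxE n (A : 'M[C]_n) : (A \is hermsymmx) = (A^t* == A).
Proof.
apply/is_hermitianmxP/eqP; rewrite expr0 scale1r; first by move=> <-.
by move=> ->.
Qed.

Variable d : nat.
Implicit Types (x y : 'I_d -> R) (A B M X Y U : 'M[C]_d).

Definition rdiag x : 'M[C]_d := diag_mx (\row_i (x i)%:C).

Lemma rdiagE x i j : rdiag x i j = (x i)%:C *+ (i == j).
Proof. by rewrite /rdiag !mxE; case: eqP => [->|]. Qed.

Lemma rdiagM x y : rdiag x *m rdiag y = rdiag (fun i => x i * y i).
Proof.
rewrite /rdiag mulmx_diag; congr diag_mx.
by apply/rowP => i; rewrite !mxE rmorphM.
Qed.

Lemma rdiagD x y : rdiag x + rdiag y = rdiag (fun i => x i + y i).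
Proof. by apply/matrixP => i j; rewrite mxE !rdiagE -mulrnDl rmorphD. Qed.

Lemma rdiagZ (c : R) x : c%:C *: rdiag x = rdiag (fun i => c * x i).
Proof. by apply/matrixP => i j; rewrite mxE !rdiagE mulrnAr rmorphM. Qed.

Lemma rdiag_cst (c : R) : rdiag (fun=> c) = (c%:C)%:M.
Proof. by apply/matrixP => i j; rewrite rdiagE mxE. Qed.

Lemma rdiag1 : rdiag (fun=> 1) = 1%:M.
Proof. by rewrite rdiag_cst. Qed.

Lemma ctmx_rdiag x : (rdiag x)^t* = rdiag x.
Proof.
apply/matrixP => i j; rewrite !mxE eq_sym; case: eqP => [->|_] /=.
  by rewrite !mulr1n conjC_real.
by rewrite !mulr0n rmorph0.
Qed.

Lemma det_rdiag x : \det (rdiag x) = (\prod_i x i)%:C.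
Proof.
by rewrite /rdiag det_diag rmorph_prod; apply: eq_bigr => i _; rewrite mxE.
Qed.

Lemma tr_rdiag x : \tr (rdiag x) = (\sum_i x i)%:C.
Proof.
by rewrite /rdiag mxtrace_diag rmorph_sum; apply: eq_bigr => i _; rewrite mxE.
Qed.

Lemma eq_rdiag x y : x =1 y -> rdiag x = rdiag y.
Proof. by move=> /funext ->. Qed.

Lemma rdiag_unit x : (forall i, x i != 0) -> rdiag x \in unitmx.
Proof.
move=> x0; rewrite unitmxE det_rdiag unitfE fmorph_eq0.
by apply/prodf_neq0 => i _.
Qed.

Lemma invmx_rdiag x : (forall i, x i != 0) ->
  invmx (rdiag x) = rdiag (fun i => (x i)^-1).
Proof.
move=> x0; rewrite -[RHS](mulKmx (rdiag_unit x0)) rdiagM.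
rewrite (@eq_rdiag (fun i => x i / x i) (fun=> 1)) => [|i]; last exact: divff.
by rewrite rdiag1 mulmx1.
Qed.

(** [Y] is merely invertible, not unitary: the definition is meant for products [invmx A *m B],
    which need not be Hermitian. *)
Definition rdiagonalized M x :=
  exists2 Y, Y \in unitmx & M = invmx Y *m rdiag x *m Y.

(** [Z] intertwines [rdiag x] and [rdiag y], so a nonzero entry [Z i j] forces [x j = y i]. Hence
    [Z] also intertwines the diagonals of [f \o x] and [f \o y], whose traces therefore agree. No
    ordering or counting of eigenvalues is involved. *)
Lemma sum_rdiagonalized (f : R -> R) M x y :
  rdiagonalized M x -> rdiagonalized M y -> \sum_i f (x i) = \sum_i f (y i).
Proof.
move=> [X Xu ->] [Y Yu XY]; pose Z := Y *m invmx X.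
have Zu : Z \in unitmx by rewrite unitmx_mul Yu unitmx_inv.
have ZE : Z *m rdiag x = rdiag y *m Z.
  rewrite /Z; move/(congr1 (mulmx Y))/(congr1 (mulmx^~ (invmx X))): XY.
  by rewrite !mulmxA (mulmxK Xu) (mulmxV Yu) mul1mx.
have fZ : Z *m rdiag (f \o x) = rdiag (f \o y) *m Z.
  move: ZE; clearbody Z => ZE; apply/matrixP => i j; have /matrixP/(_ i j) := ZE.
  rewrite /rdiag !mul_mx_diag !mul_diag_mx !mxE => E.
  have [->|z0] := eqVneq (Z i j) 0; first by rewrite mul0r mulr0.
  have /complexI xy : (x j)%:C = (y i)%:C by apply: (mulfI z0); rewrite E mulrC.
  by rewrite /= xy mulrC.
apply: (@complexI R); rewrite -[LHS]tr_rdiag -[RHS]tr_rdiag.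
rewrite -[rdiag (f \o x)](mulKmx Zu) fZ mxtrace_mulC -mulmxA.
by rewrite (mulmxV Zu) mulmx1.
Qed.

Lemma rdiagonalized_conj M x X : X \in unitmx ->
  rdiagonalized M x -> rdiagonalized (invmx X *m M *m X) x.
Proof.
move=> Xu [Y Yu ->]; exists (Y *m X); first by rewrite unitmx_mul Yu.
by rewrite (invmxM Yu Xu) !mulmxA.
Qed.

Lemma rdiagonalizedV M x : (forall i, x i != 0) ->
  rdiagonalized M x -> rdiagonalized (invmx M) (fun i => (x i)^-1).
Proof.
move=> x0 [Y Yu ->]; exists Y => //.
have xu := rdiag_unit x0.
have Yiu : invmx Y \in unitmx by rewrite unitmx_inv.
rewrite (invmxM _ Yu) ?unitmx_mul ?Yiu// (invmxM Yiu xu).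
by rewrite invmxK invmx_rdiag// !mulmxA.
Qed.

Lemma rdiagonalizedM M N x y Y : Y \in unitmx ->
  M = invmx Y *m rdiag x *m Y -> N = invmx Y *m rdiag y *m Y ->
  M *m N = invmx Y *m rdiag (fun i => x i * y i) *m Y.
Proof.
move=> Yu -> ->; rewrite !mulmxA (mulmxK Yu).
by rewrite -!mulmxA (mulmxA (rdiag x)) rdiagM.
Qed.

Lemma tr_rdiagonalized M x : rdiagonalized M x -> \tr M = (\sum_i x i)%:C.
Proof.
by move=> [Y Yu ->]; rewrite mxtrace_mulC mulmxA (mulmxV Yu) mul1mx tr_rdiag.
Qed.

Lemma det_conj M X : X \in unitmx -> \det (invmx X *m M *m X) = \det M.
Proof.
by move=> Xu; rewrite !det_mulmx mulrAC -det_mulmx (mulVmx Xu) det1 mul1r.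
Qed.

Lemma det_rdiagonalized M x : rdiagonalized M x -> \det M = (\prod_i x i)%:C.
Proof. by move=> [Y Yu ->]; rewrite det_conj// det_rdiag. Qed.

Lemma rdiagonalized_affine (a b : R) M x : rdiagonalized M x ->
  rdiagonalized (a%:C%:M + b%:C *: M) (fun i => a + b * x i).
Proof.
move=> [Y Yu ->]; exists Y => //.
rewrite -(rdiagD (fun=> a) (fun i => b * x i)) mulmxDr mulmxDl -rdiagZ rdiag_cst.
rewrite scalar_mxC -[_%:M *m _ *m _]mulmxA (mulVmx Yu) mulmx1; congr (_ + _).
by rewrite -scalemxAr -scalemxAl.
Qed.

(** Here [a] is complex, unlike in [rdiagonalized_affine], since [det_sqr_ge] takes it purely
    imaginary. *)
Lemma det_add_scale (a : C) M x : rdiagonalized M x ->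
  \det (1%:M + a *: M) = \prod_i (1 + a * (x i)%:C).
Proof.
move=> [Y Yu ->].
have -> : 1%:M + a *: (invmx Y *m rdiag x *m Y) =
    invmx Y *m (1%:M + a *: rdiag x) *m Y.
  by rewrite mulmxDr mulmxDl mulmx1 (mulVmx Yu) -scalemxAr -scalemxAl.
rewrite det_conj//; pose w := \row_i (1 + a * (x i)%:C).
have -> : 1%:M + a *: rdiag x = diag_mx w.
  apply/matrixP => i j; rewrite !mxE; case: eqP => [->|_] /=.
    by rewrite !mulr1n.
  by rewrite !mulr0n mulr0 addr0.
by rewrite det_diag; apply: eq_bigr => i _; rewrite mxE.
Qed.

End RealDiagonal.

(** * Spectral decomposition, square roots and simultaneous diagonalisation *)

Section PositiveDefinite.
Local Open Scope sesquilinear_scope.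
Local Open Scope complex_scope.
Variables (R : realType) (d : nat).
Local Notation C := R[i].
Implicit Types (x y : 'I_d -> R) (A B M X Y U P Q : 'M[C]_d).

Lemma posdef_herm A : posdefmx A -> A^t* = A.
Proof. by move=> [+ _]; rewrite hermsymmxE => /eqP. Qed.

Lemma posdef_rdiag x : posdefmx (rdiag x) <-> forall i, 0 < x i.
Proof.
have E (v : 'cV[C]_d) : (v^t* *m rdiag x *m v) 0 0 = \sum_i (x i)%:C * `|v i 0| ^+ 2.
  rewrite /rdiag mul_mx_diag mxE; apply: eq_bigr => i _.
  by rewrite !mxE normCK; ring.
split=> [[_ h] i|x0].
  have v0 : (delta_mx i 0 : 'cV[C]_d) != 0.
    apply/eqP => /matrixP/(_ i 0); rewrite !mxE !eqxx/=.
    by move=> /eqP; rewrite oner_eq0.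
  have := h _ v0; rewrite E (bigD1 i)//= big1 => [|j ji].
    by rewrite addr0 !mxE !eqxx/= normr1 expr1n mulr1 ltcR.
  by rewrite !mxE (negbTE ji)/= normr0 expr0n/= mulr0.
split=> [|v v0]; first by rewrite hermsymmxE ctmx_rdiag.
have [i vi0] : exists i, v i 0 != 0.
  apply/existsP; apply: contraNT v0; rewrite negb_exists => /forallP v0.
  apply/eqP/colP => i; rewrite [RHS]mxE; apply/eqP.
  by have := v0 i; rewrite negbK.
rewrite E (bigD1 i)//= ltr_wpDr//.
  by apply: sumr_ge0 => j _; rewrite mulr_ge0 ?exprn_ge0// ler0c ltW.
by rewrite mulr_gt0 ?exprn_gt0 ?normr_gt0// ltcR.
Qed.

Lemma posdef_congr A X : X \in unitmx -> posdefmx A ->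
  posdefmx (X^t* *m A *m X).
Proof.
move=> Xu [hA pA]; split.
  move: hA; rewrite !hermsymmxE => /eqP hA.
  by rewrite !ctmxM trmxCK hA mulmxA.
move=> v v0; have Xv : X *m v != 0.
  by apply: contra v0 => /eqP h; rewrite -(mulKmx Xu v) h mulmx0.
by have := pA _ Xv; rewrite ctmxM !mulmxA.
Qed.

Lemma posdef1 : posdefmx (1%:M : 'M[C]_d).
Proof. by rewrite -rdiag1; apply/posdef_rdiag => i. Qed.

Lemma posdef_gram X : X \in unitmx -> posdefmx (X^t* *m X).
Proof. by move=> /posdef_congr/(_ posdef1); rewrite mulmx1. Qed.

Lemma posdef_gram_rdiag X x : X \in unitmx -> (forall i, 0 < x i) ->
  posdefmx (X^t* *m rdiag x *m X).
Proof. by move=> Xu /posdef_rdiag; apply: posdef_congr. Qed.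

Definition eigenvalues A (i : 'I_d) : R := complex.Re (spectral_diag A 0 i).

Lemma spectral_ctmx A : (spectralmx A)^t* = invmx (spectralmx A).
Proof. by rewrite invmx_unitary// spectral_unitarymx. Qed.

Lemma posdef_spectral A : posdefmx A ->
  A = (spectralmx A)^t* *m rdiag (eigenvalues A) *m spectralmx A /\
  forall i, 0 < eigenvalues A i.
Proof.
move=> hA; have [hA' _] := hA; set P := spectralmx A.
have Pu : P \in unitmx by apply: spectral_unit.
have AE : A = P^t* *m rdiag (eigenvalues A) *m P.
  have /hermitian_normalmx/orthomx_spectralP := hA'.
  rewrite -/P spectral_ctmx -/P /rdiag.
  suff -> : \row_i (eigenvalues A i)%:C = spectral_diag A by [].
  apply/rowP => i; rewrite mxE RRe_real//.
  by have /mxOverP/(_ 0 i) := hermitian_spectral_diag_real hA'.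
split=> //; apply/posdef_rdiag.
have -> : rdiag (eigenvalues A) = (invmx P)^t* *m A *m invmx P.
  rewrite {2}AE ctmxV !mulmxA mulVmx ?ctmx_unit// mul1mx -mulmxA.
  by rewrite (mulmxV Pu) mulmx1.
by apply: posdef_congr => //; rewrite unitmx_inv.
Qed.

Lemma powmxE A (t : R) : powmx A t =
  (spectralmx A)^t* *m rdiag (fun i => eigenvalues A i `^ t) *m spectralmx A.
Proof.
rewrite /powmx spectral_ctmx /rdiag.
have -> // : map_mx (fun z : C => ((complex.Re z `^ t)%:C)) (spectral_diag A) =
    \row_i (eigenvalues A i `^ t)%:C.
by apply/rowP => i; rewrite !mxE.
Qed.

Local Opaque powmx invmx spectralmx spectral_diag.

Lemma det_posdef A : posdefmx A -> exists2 p : R, 0 < p & \det A = p%:C.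
Proof.
move=> /posdef_spectral[AE A0]; exists (\prod_i eigenvalues A i).
  by apply: prodr_gt0 => i _.
by rewrite [in LHS]AE spectral_ctmx det_conj ?spectral_unit// det_rdiag.
Qed.

Lemma posdef_unit A : posdefmx A -> A \in unitmx.
Proof.
move=> /det_posdef[p p0 Ap]; rewrite unitmxE Ap unitfE fmorph_eq0.
by rewrite gt_eqF.
Qed.

Lemma posdef_sqrt A : posdefmx A -> exists2 S,
  [/\ S^t* = S, S \in unitmx & S *m S = A] &
  powmx A 2^-1 = S /\ powmx A (- 2^-1) = invmx S.
Proof.
move=> hA; have [AE A0] := posdef_spectral hA.
rewrite !powmxE.
have := @spectral_ctmx A; have := @spectral_unit _ _ A.
move: (spectralmx A) (eigenvalues A) AE A0 => P x AE A0 Pu PV.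
have PP : P *m P^t* = 1%:M by rewrite PV mulmxV.
have x0 t i : x i `^ t != 0 by rewrite gt_eqF// powR_gt0.
eexists; last by split; first reflexivity; shelve.
split.
- by rewrite !ctmxM trmxCK ctmx_rdiag mulmxA.
- by rewrite !unitmx_mul ctmx_unit Pu rdiag_unit.
- rewrite [RHS]AE !mulmxA -[_ *m P *m P^t*]mulmxA PP mulmx1.
  rewrite -[_ *m rdiag _ *m rdiag _]mulmxA rdiagM.
  rewrite (@eq_rdiag _ _ _ x)// => i.
  rewrite -powRD ?gt_eqF ?implybT//.
  by rewrite -[2^-1]mul1r -splitr powRr1// ltW.
Unshelve.
- rewrite PV (invmxM _ Pu) ?unitmx_mul ?unitmx_inv ?Pu ?rdiag_unit//.
  rewrite invmxM ?unitmx_inv ?rdiag_unit// invmxK invmx_rdiag// mulmxA.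
  have -> : rdiag (fun i => x i `^ (- 2^-1)) = rdiag (fun i => (x i `^ 2^-1)^-1).
    by apply: eq_rdiag => i; rewrite powRN.
  exact: erefl.
Qed.

Lemma frobenius_sqr M : frobenius_norm M ^+ 2 = complex.Re (\tr (M *m M^t*)).
Proof.
rewrite sqr_sqrtr; last first.
  by apply: sumr_ge0 => i _; apply: sumr_ge0 => j _; apply: sqr_ge0.
apply: (@complexI R); rewrite rmorph_sum RRe_real/=.
  rewrite /mxtrace; apply: eq_bigr => i _; rewrite rmorph_sum mxE.
  by apply: eq_bigr => j _; rewrite !mxE -normCK rmorphXn.
rewrite realE /mxtrace; apply/orP; left; apply: sumr_ge0 => i _.
by rewrite mxE; apply: sumr_ge0 => j _; rewrite !mxE -normCK exprn_ge0.
Qed.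

Lemma mxtrace_sandwich (K : comNzRingType) n (S M N : 'M[K]_n) :
  \tr (S *m M *m S *m (S *m (N *m S))) = \tr (S *m S *m M *m (S *m S) *m N).
Proof. by rewrite !mulmxA mxtrace_mulC !mulmxA. Qed.

Lemma frobenius_congr A M : posdefmx A ->
  frobenius_norm (powmx A (- 2^-1) *m M *m powmx A (- 2^-1)) ^+ 2 =
  complex.Re (\tr (invmx A *m M *m invmx A *m M^t*)).
Proof.
move=> /posdef_sqrt[S [Sh Su SS] [_ ->]].
rewrite frobenius_sqr !ctmxM ctmxV Sh -SS (invmxM Su Su).
by rewrite mxtrace_sandwich.
Qed.

(** Simultaneous diagonalisation by congruence: X = Q A^(1/2) with Q a unitary matrix diagonalising
    A^(-1/2) B A^(-1/2). It reduces questions about two positive definite matrices and their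
    geodesic to scalars. *)
Lemma posdef_simdiag A B : posdefmx A -> posdefmx B ->
  exists X, exists2 x, X \in unitmx /\ (forall i, 0 < x i) &
  [/\ A = X^t* *m X, B = X^t* *m rdiag x *m X &
      forall t, mx_geodesic A B t = X^t* *m rdiag (fun i => x i `^ t) *m X].
Proof.
move=> /posdef_sqrt[S [Sh Su SS] [S1 S2]] hB; rewrite /mx_geodesic S1 S2.
set N := invmx S *m B *m invmx S.
have hN : posdefmx N.
  rewrite /N -[X in invmx X *m B]Sh -ctmxV.
  by apply: posdef_congr => //; rewrite unitmx_inv.
have [NE N0] := posdef_spectral hN.
have [Qu QV] := (spectral_unit N, spectral_ctmx N).
have powE := powmxE N; move: (spectralmx N) (eigenvalues N) => Q x in NE N0 Qu QV powE *.
exists (Q *m S), x; first by rewrite unitmx_mul Qu Su.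
rewrite ctmxM Sh; split.
- by rewrite mulmxA -(mulmxA S) QV (mulVmx Qu) mulmx1.
- rewrite !mulmxA -(mulmxA S) -(mulmxA S) -NE /N !mulmxA (mulmxV Su) mul1mx.
  by rewrite -mulmxA (mulVmx Su) mulmx1.
- by move=> t; rewrite powE !mulmxA.
Qed.

Lemma posdef_geodesic A B t : posdefmx A -> posdefmx B ->
  posdefmx (mx_geodesic A B t).
Proof.
move=> hA hB; have [X [x [Xu x0] [_ _ ->]]] := posdef_simdiag hA hB.
by apply: posdef_gram_rdiag => // i; apply: powR_gt0.
Qed.

End PositiveDefinite.

(** * Convergence of complex matrices *)

Section ComplexConvergence.
Local Open Scope sesquilinear_scope.
Local Open Scope complex_scope.
Local Open Scope classical_set_scope.
Variables (R : realType) (T : Type) (F : set_system T).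
Context {FF : Filter F}.
Local Notation C := R[i].
Implicit Types (f g : T -> C) (l k : C).

(* R[i] carries no topology in the library: convergence is stated for real and
   imaginary parts. *)
Definition ccvg f l :=
  (fun t => complex.Re (f t)) @ F --> complex.Re l /\
  (fun t => complex.Im (f t)) @ F --> complex.Im l.

Lemma ccvg_cst l : ccvg (fun=> l) l.
Proof. by split; apply: cvg_cst. Qed.

Lemma ccvg_real (f : T -> R) (l : R) :
  f @ F --> l -> ccvg (fun t => (f t)%:C) (l%:C).
Proof. by move=> fl; split=> //=; apply: cvg_cst. Qed.

Lemma complex_ReD (x y : C) : complex.Re (x + y) = complex.Re x + complex.Re y.
Proof. by case: x => a b; case: y. Qed.

Lemma complex_ImD (x y : C) : complex.Im (x + y) = complex.Im x + complex.Im y.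
Proof. by case: x => a b; case: y. Qed.

Lemma complex_ReB (x y : C) : complex.Re (x - y) = complex.Re x - complex.Re y.
Proof. by case: x => a b; case: y. Qed.

Lemma complex_ImB (x y : C) : complex.Im (x - y) = complex.Im x - complex.Im y.
Proof. by case: x => a b; case: y. Qed.

Lemma complex_ReM (x y : C) : complex.Re (x * y) =
  complex.Re x * complex.Re y - complex.Im x * complex.Im y.
Proof. by case: x => a b; case: y. Qed.

Lemma complex_ImM (x y : C) : complex.Im (x * y) =
  complex.Re x * complex.Im y + complex.Im x * complex.Re y.
Proof. by case: x => a b; case: y. Qed.

Lemma ccvgD f g l k : ccvg f l -> ccvg g k -> ccvg (fun t => f t + g t) (l + k).
Proof.
move=> [f1 f2] [g1 g2]; rewrite /ccvg complex_ReD complex_ImD.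
split; [under eq_fun do rewrite complex_ReD|under eq_fun do rewrite complex_ImD];
  exact: cvgD.
Qed.

Lemma ccvgM f g l k : ccvg f l -> ccvg g k -> ccvg (fun t => f t * g t) (l * k).
Proof.
move=> [f1 f2] [g1 g2]; rewrite /ccvg complex_ReM complex_ImM; split.
  under eq_fun do rewrite complex_ReM; by apply: cvgB; apply: cvgM.
under eq_fun do rewrite complex_ImM; by apply: cvgD; apply: cvgM.
Qed.

Lemma ccvgN f l : ccvg f l -> ccvg (fun t => - f t) (- l).
Proof.
move=> /(ccvgM (ccvg_cst (-1))); rewrite mulN1r.
by under eq_fun do rewrite mulN1r.
Qed.

Lemma ccvg_conj f l : ccvg f l -> ccvg (fun t => Num.conj (f t)) (Num.conj l).
Proof.
move=> [f1 f2].
have ReJ (z : C) : complex.Re (Num.conj z) = complex.Re z by case: z.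
have ImJ (z : C) : complex.Im (Num.conj z) = - complex.Im z by case: z.
rewrite /ccvg ReJ ImJ; split.
  by under eq_fun do rewrite ReJ.
by under eq_fun do rewrite ImJ; exact: cvgN.
Qed.

Lemma ccvg_sum (I : Type) (r : seq I) (P : pred I) (f : I -> T -> C) (l : I -> C) :
  (forall i, ccvg (f i) (l i)) ->
  ccvg (fun t => \sum_(i <- r | P i) f i t) (\sum_(i <- r | P i) l i).
Proof.
move=> fl; elim: r => [|i r IH].
  by rewrite big_nil; under eq_fun do rewrite big_nil; exact: ccvg_cst.
rewrite big_cons; under eq_fun do rewrite big_cons.
by case: ifP => // _; apply: ccvgD.
Qed.

Lemma ccvg_prod (I : Type) (r : seq I) (P : pred I) (f : I -> T -> C) (l : I -> C) :
  (forall i, ccvg (f i) (l i)) ->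
  ccvg (fun t => \prod_(i <- r | P i) f i t) (\prod_(i <- r | P i) l i).
Proof.
move=> fl; elim: r => [|i r IH].
  by rewrite big_nil; under eq_fun do rewrite big_nil; exact: ccvg_cst.
rewrite big_cons; under eq_fun do rewrite big_cons.
by case: ifP => // _; apply: ccvgM.
Qed.

Lemma ccvgV f l : l != 0 -> ccvg f l -> ccvg (fun t => (f t)^-1) l^-1.
Proof.
move=> l0 [f1 f2]; pose n (z : C) := complex.Re z ^+ 2 + complex.Im z ^+ 2.
have nl0 : n l != 0.
  rewrite /n paddr_eq0 ?sqr_ge0// !sqrf_eq0; apply: contra l0.
  by rewrite eq_complex.
have ReV (z : C) : complex.Re z^-1 = complex.Re z * (n z)^-1 by case: z.
have ImV (z : C) : complex.Im z^-1 = - complex.Im z * (n z)^-1.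
  by case: z => a b; rewrite /n/= mulNr.
have nf : (fun t => (n (f t))^-1) @ F --> (n l)^-1.
  by apply: cvgV => //; apply: cvgD; apply: cvgM.
rewrite /ccvg ReV ImV; split.
  by under eq_fun do rewrite ReV; exact: cvgM.
by under eq_fun do rewrite ImV; apply: cvgM => //; exact: cvgN.
Qed.

Section Matrices.
Variables (m n p : nat).

Definition mxcvg m n (f : T -> 'M[C]_(m, n)) (l : 'M[C]_(m, n)) :=
  forall i j, ccvg (fun t => f t i j) (l i j).

Lemma mxcvg_cst (l : 'M[C]_(m, n)) : mxcvg (fun=> l) l.
Proof. by move=> i j; apply: ccvg_cst. Qed.

Lemma mxcvgD (f g : T -> 'M[C]_(m, n)) (l k : 'M[C]_(m, n)) :
  mxcvg f l -> mxcvg g k -> mxcvg (fun t => f t + g t) (l + k).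
Proof.
move=> fl gk i j; rewrite mxE; under eq_fun do rewrite mxE.
exact: ccvgD.
Qed.

Lemma mxcvgN (f : T -> 'M[C]_(m, n)) (l : 'M[C]_(m, n)) :
  mxcvg f l -> mxcvg (fun t => - f t) (- l).
Proof.
move=> fl i j; rewrite mxE; under eq_fun do rewrite mxE.
exact: ccvgN.
Qed.

Lemma mxcvgM (f : T -> 'M[C]_(m, n)) (g : T -> 'M[C]_(n, p))
    (l : 'M[C]_(m, n)) (k : 'M[C]_(n, p)) :
  mxcvg f l -> mxcvg g k -> mxcvg (fun t => f t *m g t) (l *m k).
Proof.
move=> fl gk i j; rewrite mxE; under eq_fun do rewrite mxE.
by apply: ccvg_sum => a; apply: ccvgM.
Qed.

Lemma mxcvgZ (f : T -> C) (g : T -> 'M[C]_(m, n)) l (k : 'M[C]_(m, n)) :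
  ccvg f l -> mxcvg g k -> mxcvg (fun t => f t *: g t) (l *: k).
Proof.
move=> fl gk i j; rewrite mxE; under eq_fun do rewrite mxE.
by apply: ccvgM.
Qed.

Lemma mxcvg_ctmx (f : T -> 'M[C]_(m, n)) (l : 'M[C]_(m, n)) :
  mxcvg f l -> mxcvg (fun t => (f t)^t*) (l^t*).
Proof.
move=> fl i j; rewrite !mxE; under eq_fun do rewrite !mxE.
exact: ccvg_conj.
Qed.

Lemma ccvg_mxtrace (f : T -> 'M[C]_n) (l : 'M[C]_n) :
  mxcvg f l -> ccvg (fun t => \tr (f t)) (\tr l).
Proof. by move=> fl; apply: ccvg_sum. Qed.

Lemma ccvg_det (r : nat) (f : T -> 'M[C]_r) (l : 'M[C]_r) :
  mxcvg f l -> ccvg (fun t => \det (f t)) (\det l).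
Proof.
move=> fl; apply: ccvg_sum => s; apply: ccvgM; first exact: ccvg_cst.
exact: ccvg_prod.
Qed.

Lemma mxcvg_adj (f : T -> 'M[C]_n) (l : 'M[C]_n) :
  mxcvg f l -> mxcvg (fun t => \adj (f t)) (\adj l).
Proof.
move=> fl i j; rewrite mxE; under eq_fun do rewrite mxE.
apply: ccvgM; first exact: ccvg_cst.
apply: ccvg_det => a b; rewrite !mxE; under eq_fun do rewrite !mxE.
exact: fl.
Qed.

End Matrices.

(** By Cramer's formula the entries of the inverse are rational in those of the matrix.
    Invertibility along the filter matters because [invmx] returns a singular matrix unchanged. *)
Lemma mxcvg_invmx n (f : T -> 'M[C]_n) (l : 'M[C]_n) :
  (\forall t \near F, f t \in unitmx) -> l \in unitmx -> mxcvg f l -> mxcvg (fun t => invmx (f t)) (invmx l).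
Proof.
move=> fu lu fl.
have l0 : \det l != 0 by move: lu; rewrite unitmxE unitfE.
have H := mxcvgZ (ccvgV l0 (ccvg_det fl)) (mxcvg_adj fl).
move=> i j; rewrite /invmx lu; have [H1 H2] := H i j.
by split; [apply: cvg_trans H1|apply: cvg_trans H2];
  apply: near_eq_cvg; apply: filterS fu => t /= ->.
Qed.

Lemma mxcvg_rdiag n (f : T -> 'I_n -> R) (l : 'I_n -> R) :
  (forall i, (fun t => f t i) @ F --> l i) ->
  mxcvg (fun t => diag_mx (\row_i (f t i)%:C)) (diag_mx (\row_i (l i)%:C)).
Proof.
move=> fl i j; rewrite !mxE; under eq_fun do rewrite !mxE.
case: (i == j); last by under eq_fun do rewrite mulr0n; exact: ccvg_cst.
by under eq_fun do rewrite mulr1n; exact: ccvg_real.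
Qed.

End ComplexConvergence.

(** * The distance rho *)

HB.lock Definition rho (R : realType) (d : nat) (A B : 'M[R[i]]_d) : R :=
  Num.sqrt (\sum_i
    ln (eigenvalues (powmx A (- 2^-1) *m B *m powmx A (- 2^-1)) i) ^+ 2).

Section RiemannianDistance.
Local Open Scope sesquilinear_scope.
Local Open Scope complex_scope.
Variables (R : realType) (d : nat).
Local Notation C := R[i].
Implicit Types (x y a b : 'I_d -> R) (A B M X Y U P Q : 'M[C]_d).

Lemma rho_ge0 A B : 0 <= rho A B.
Proof. by rewrite rho.unlock sqrtr_ge0. Qed.

Lemma gram_rdiagonalized X a b : X \in unitmx -> (forall i, 0 < a i) ->
  rdiagonalized (invmx (X^t* *m rdiag a *m X) *m (X^t* *m rdiag b *m X))
    (fun i => (a i)^-1 * b i).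
Proof.
move=> Xu a0; have Xu' : X^t* \in unitmx by rewrite ctmx_unit.
have au : rdiag a \in unitmx by apply: rdiag_unit => i; rewrite gt_eqF.
have Xau : X^t* *m rdiag a \in unitmx by rewrite unitmx_mul Xu' au.
exists X => //; rewrite (invmxM Xau Xu) (invmxM Xu' au).
rewrite -rdiagM -invmx_rdiag => [|i]; last by rewrite gt_eqF.
by rewrite !mulmxA -(mulmxA _ (invmx (X^t*))) (mulVmx Xu') mulmx1.
Qed.

Lemma posdef_rdiagonalized A B : posdefmx A -> posdefmx B ->
  exists2 x, (forall i, 0 < x i) & rdiagonalized (invmx A *m B) x.
Proof.
move=> hA hB; have [X [x [Xu x0] [-> -> _]]] := posdef_simdiag hA hB.
exists x => //; have := @gram_rdiagonalized X (fun=> 1) x Xu (fun=> ltr01).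
rewrite rdiag1 mulmx1.
by under [X in rdiagonalized _ X]eq_fun do rewrite invr1 mul1r.
Qed.

(** [invmx A *m B] is similar to A^(-1/2) B A^(-1/2), and by [sum_rdiagonalized] any diagonalisation
    of it may be used; square roots thus leave the later computations. *)
Lemma rhoE A B x : posdefmx A -> posdefmx B ->
  rdiagonalized (invmx A *m B) x -> rho A B ^+ 2 = \sum_i ln (x i) ^+ 2.
Proof.
move=> hA hB ABx; rewrite rho.unlock sqr_sqrtr; last first.
  by apply: sumr_ge0 => i _; apply: sqr_ge0.
apply: (@sum_rdiagonalized _ _ (fun z => ln z ^+ 2) _ _ _ _ ABx).
have [S [Sh Su SS] [_ ->]] := posdef_sqrt hA.
have hN : posdefmx (invmx S *m B *m invmx S).
  rewrite -[X in invmx X *m B]Sh -ctmxV.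
  by apply: posdef_congr => //; rewrite unitmx_inv.
have [NE _] := posdef_spectral hN.
have -> : invmx A *m B = invmx S *m (invmx S *m B *m invmx S) *m S.
  by rewrite -SS (invmxM Su Su) !mulmxA mulmxKV.
apply: (rdiagonalized_conj Su); exists (spectralmx (invmx S *m B *m invmx S)).
  exact: spectral_unit.
by rewrite -spectral_ctmx.
Qed.

Lemma eq_rho A B A' B' : rho A B ^+ 2 = rho A' B' ^+ 2 -> rho A B = rho A' B'.
Proof. by move=> /eqP; rewrite eqrXn2 ?rho_ge0// => /eqP. Qed.

Lemma rho_gram X a b : X \in unitmx -> (forall i, 0 < a i) -> (forall i, 0 < b i) ->
  rho (X^t* *m rdiag a *m X) (X^t* *m rdiag b *m X) ^+ 2 =
  \sum_i (ln (b i) - ln (a i)) ^+ 2.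
Proof.
move=> Xu a0 b0; rewrite (rhoE _ _ (gram_rdiagonalized b Xu a0));
  try exact: posdef_gram_rdiag.
by apply: eq_bigr => i _; rewrite lnM ?posrE ?invr_gt0// lnV ?posrE// addrC.
Qed.

Lemma rho_congr A B X : X \in unitmx -> posdefmx A -> posdefmx B ->
  rho (X^t* *m A *m X) (X^t* *m B *m X) = rho A B.
Proof.
move=> Xu hA hB; have [x x0 ABx] := posdef_rdiagonalized hA hB.
have Xu' : X^t* \in unitmx by rewrite ctmx_unit.
have Au := posdef_unit hA.
apply: eq_rho; rewrite (rhoE hA hB ABx); apply: rhoE; try exact: posdef_congr.
have XAu : X^t* *m A \in unitmx by rewrite unitmx_mul Xu' Au.
have -> : invmx (X^t* *m A *m X) *m (X^t* *m B *m X) =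
    invmx X *m (invmx A *m B) *m X.
  rewrite (invmxM XAu Xu) (invmxM Xu' Au).
  by rewrite !mulmxA -(mulmxA _ (invmx (X^t*))) (mulVmx Xu') mulmx1.
exact: rdiagonalized_conj.
Qed.

Lemma invmx_mulVmx A B : A \in unitmx -> B \in unitmx ->
  invmx (invmx A *m B) = invmx B *m A.
Proof.
move=> Au Bu; have Au' : invmx A \in unitmx by rewrite unitmx_inv.
by rewrite (invmxM Au' Bu) invmxK.
Qed.

Lemma diff_sandwich A B : A \in unitmx -> B \in unitmx ->
  invmx A *m (B - A) *m invmx B *m (B - A) =
  invmx A *m B + invmx B *m A - (1%:M + 1%:M).
Proof.
move=> Au Bu; have -> : invmx A *m (B - A) *m invmx B = invmx A - invmx B.
  by rewrite mulmxBr (mulVmx Au) mulmxBl (mulmxK Bu) mul1mx.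
rewrite mulmxBl !mulmxBr (mulVmx Au) (mulVmx Bu).
by rewrite opprB opprD addrACA.
Qed.

Lemma rho_sym A B : posdefmx A -> posdefmx B -> rho A B = rho B A.
Proof.
move=> hA hB; have [x x0 ABx] := posdef_rdiagonalized hA hB.
have [Au Bu] := (posdef_unit hA, posdef_unit hB).
apply: eq_rho; rewrite (rhoE hA hB ABx).
have := rdiagonalizedV (fun i => lt0r_neq0 (x0 i)) ABx.
rewrite (invmx_mulVmx Au Bu) => /(rhoE hB hA) ->.
by apply: eq_bigr => i _; rewrite lnV ?posrE// sqrrN.
Qed.

Lemma rho_refl A : posdefmx A -> rho A A = 0.
Proof.
move=> hA; apply/eqP; rewrite -sqrf_eq0 (@rhoE _ _ (fun=> 1))//.
  by rewrite big1// => i _; rewrite ln1 expr0n.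
exists 1%:M; first exact: unitmx1.
by rewrite (mulVmx (posdef_unit hA)) rdiag1 invmx1 !mulmx1.
Qed.

(* With M = A^-1 B the right-hand side is the trace of M + M^-1 - 2. *)
Lemma rho_sqr_le_tr A B : posdefmx A -> posdefmx B ->
  rho A B ^+ 2 <= complex.Re (\tr (invmx A *m (B - A) *m invmx B *m (B - A))).
Proof.
move=> hA hB; have [x x0 ABx] := posdef_rdiagonalized hA hB.
have [Au Bu] := (posdef_unit hA, posdef_unit hB).
have BAx : rdiagonalized (invmx B *m A) (fun i => (x i)^-1).
  have := rdiagonalizedV (fun i => lt0r_neq0 (x0 i)) ABx.
  by rewrite (invmx_mulVmx Au Bu).
have -> := diff_sandwich Au Bu.
rewrite raddfB !raddfD /= !mxtrace1.
rewrite (tr_rdiagonalized ABx) (tr_rdiagonalized BAx) (rhoE hA hB ABx).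
have -> : (d%:R : C) = (\sum_(i < d) 1)%:C.
  by rewrite sumr_const card_ord rmorph_nat.
rewrite /= -opprD -!big_split/= -sumrB; apply: ler_sum => i _.
exact: ln_sqr_le.
Qed.

(** Midpoint log-concavity of the determinant; after simultaneous diagonalisation it is x <= ((1 +
    x) / 2)^2 for each eigenvalue. *)
Lemma det_posdef_mean A B : posdefmx A -> posdefmx B ->
  complex.Re (\det A) * complex.Re (\det B) <=
  complex.Re (\det (2^-1%:C *: (A + B))) ^+ 2.
Proof.
move=> hA hB; have [X [x [Xu x0] [AE BE _]]] := posdef_simdiag hA hB.
have [p p0 pE] := det_posdef hA.
have dE y : \det (X^t* *m rdiag y *m X) = (p * \prod_i y i)%:C.
  by rewrite !det_mulmx det_rdiag mulrAC -det_mulmx -AE pE rmorphM.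
have -> : 2^-1%:C *: (A + B) = X^t* *m rdiag (fun i => 2^-1 * (1 + x i)) *m X.
  rewrite -rdiagZ -rdiagD rdiag1 AE BE -scalemxAr -scalemxAl.
  by rewrite mulmxDr mulmxDl mulmx1.
rewrite BE !dE pE/= mulrA -expr2 exprMn ler_wpM2l ?sqr_ge0//.
rewrite -prodrXl; apply: ler_prod => i _; rewrite (ltW (x0 i))/=.
have -> : (2^-1 * (1 + x i)) ^+ 2 = x i + (2^-1 * (1 - x i)) ^+ 2 by field.
by rewrite lerDl sqr_ge0.
Qed.

Lemma posdef_sqr A : posdefmx A -> posdefmx (A *m A).
Proof.
by move=> hA; rewrite -{1}(posdef_herm hA); apply/posdef_gram/posdef_unit.
Qed.

Lemma mul_sum_diff (K : comNzRingType) n (P W : 'M[K]_n) :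
  (P + W) *m (P - W) + (P - W) *m (P + W) = (P *m P - W *m W) + (P *m P - W *m W).
Proof.
rewrite !mulmxDl !mulmxDr !mulmxN !mulNmx.
move: (P *m P) (P *m W) (W *m P) (W *m W) => A B D E.
by apply/matrixP => i j; rewrite !mxE; ring.
Qed.

(* Z = P + i sqrt c Q satisfies P^2 + c Q^2 = (Z Z^* + Z^* Z) / 2 and
   |det Z|^2 = det P^2 * prod (1 + c x_i^2). *)
Lemma det_sqr_ge P Q x y (c : R) : posdefmx P -> posdefmx Q -> 0 < c ->
  rdiagonalized (invmx P *m Q) x ->
  rdiagonalized (invmx (P *m P) *m (Q *m Q)) y ->
  (forall i, 0 < y i) ->
  \prod_i (1 + c * x i ^+ 2) <= \prod_i (1 + c * y i).
Proof.
move=> hP hQ c0 Px PPy y0.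
have Pu := posdef_unit hP; have [p p0 pE] := det_posdef hP.
have PPu : P *m P \in unitmx by rewrite unitmx_mul Pu.
pose j : C := Complex 0 (Num.sqrt c).
have jj : j * j = - c%:C.
  apply/eqP; rewrite eq_complex /= !mulr0 !mul0r ?addr0 oppr0 sub0r eqxx andbT.
  by rewrite -expr2 sqr_sqrtr// ltW.
have jc : Num.conj j = - j by apply/eqP; rewrite eq_complex /= oppr0 !eqxx.
pose W : 'M[C]_d := j *: Q; pose Z : 'M[C]_d := P + W.
have Wc : W^t* = - W.
  apply/matrixP => k l; rewrite !mxE rmorphM/= jc mulNr.
  by have /matrixP/(_ k l) := posdef_herm hQ; rewrite !mxE => ->.
have Zc : Z^t* = P - W.
  have := posdef_herm hP; move: Wc; rewrite /Z.
  move=> /matrixP Wc /matrixP Pc; apply/matrixP => k l.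
  have := Wc k l; have := Pc k l; rewrite !mxE rmorphD/= => -> ->.
  by [].
have WW : W *m W = - (c%:C *: (Q *m Q)).
  by rewrite /W -scalemxAl -scalemxAr scalerA jj scaleNr.
have detZ : \det Z = p%:C * \prod_i (1 + j * (x i)%:C).
  rewrite -(det_add_scale j Px) -pE -det_mulmx mulmxDr mulmx1.
  by rewrite -scalemxAr (mulKVmx Pu).
have detZc : \det (Z^t*) = p%:C * \prod_i (1 - j * (x i)%:C).
  rewrite det_ctmx detZ rmorphM/= conjC_real rmorph_prod.
  congr (_ * _); apply: eq_bigr => i _.
  by rewrite rmorphD rmorphM/= rmorph1 conjC_real jc mulNr.
have nZ : \det Z * \det (Z^t*) = (p ^+ 2 * \prod_i (1 + c * x i ^+ 2))%:C.
  rewrite detZ detZc mulrACA -big_split/= rmorphM rmorphXn -expr2.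
  congr (_ * _); rewrite rmorph_prod; apply: eq_bigr => i _.
  rewrite rmorphD rmorphM rmorphXn/= rmorph1.
  have -> : c%:C = - (j * j) by rewrite jj opprK.
  by ring.
have q0 : 0 < p ^+ 2 * \prod_i (1 + c * x i ^+ 2).
  rewrite mulr_gt0 ?exprn_gt0//; apply: prodr_gt0 => i _.
  by rewrite ltr_wpDr// mulr_ge0 ?sqr_ge0// ltW.
have Zu : Z \in unitmx.
  rewrite unitmxE unitfE; apply/eqP => Z0; move: nZ; rewrite Z0 mul0r.
  by move=> /complexI/eqP; rewrite lt_eqF.
have Zu' : Z^t* \in unitmx by rewrite ctmx_unit.
have hZ := posdef_gram Zu; have := posdef_gram Zu'; rewrite trmxCK => hZ'.
(* Z Z^* and Z^* Z have the same determinant |det Z|^2, so log-concavity bounds its square by that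
   of the determinant of their mean. *)
have := det_posdef_mean hZ' hZ.
have -> : 2^-1%:C *: (Z *m Z^t* + Z^t* *m Z) = P *m P + c%:C *: (Q *m Q).
  rewrite Zc /Z mul_sum_diff WW opprK scalerDr -scalerDl -rmorphD.
  have -> : 2^-1 + 2^-1 = 1 :> R by field.
  by rewrite rmorph1 scale1r.
have -> : \det (P *m P + c%:C *: (Q *m Q)) = (p ^+ 2 * \prod_i (1 + c * y i))%:C.
  have -> : P *m P + c%:C *: (Q *m Q) =
      P *m P *m (1%:M + c%:C *: (invmx (P *m P) *m (Q *m Q))).
    by rewrite mulmxDr mulmx1 -scalemxAr (mulKVmx PPu).
  rewrite det_mulmx (det_add_scale _ PPy) det_mulmx pE rmorphM rmorphXn expr2.
  congr (_ * _); rewrite rmorph_prod; apply: eq_bigr => i _.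
  by rewrite rmorphD rmorphM rmorph1.
rewrite !det_mulmx [\det (Z^t*) * _]mulrC nZ /=.
rewrite -expr2 ler_sqr ?nnegrE ?(ltW q0)//.
  by rewrite ler_pM2l// exprn_gt0.
rewrite mulr_ge0 ?sqr_ge0//; apply: prodr_ge0 => i _.
by rewrite addr_ge0// mulr_ge0// ltW.
Qed.

Lemma rho_sqr P Q : posdefmx P -> posdefmx Q ->
  4 * rho P Q ^+ 2 <= rho (P *m P) (Q *m Q) ^+ 2.
Proof.
move=> hP hQ; have [hPP hQQ] := (posdef_sqr hP, posdef_sqr hQ).
have Pu := posdef_unit hP.
have [x x0 Px] := posdef_rdiagonalized hP hQ.
have [y y0 PPy] := posdef_rdiagonalized hPP hQQ.
rewrite (rhoE hP hQ Px) (rhoE hPP hQQ PPy) mulr_sumr.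
have -> : \sum_i 4 * ln (x i) ^+ 2 = \sum_i ln (x i ^+ 2) ^+ 2.
  by apply: eq_bigr => i _; rewrite lnXn// mulr2n; ring.
apply: sum_ln_sqr_le => //.
- by move=> i; rewrite exprn_gt0.
- by move=> c c0; apply: det_sqr_ge PPy _.
(* Both products equal (det Q / det P)^2. *)
apply: (@complexI R); rewrite -(det_rdiagonalized PPy) prodrXl rmorphXn.
rewrite /= -(det_rdiagonalized Px) (invmxM Pu Pu) !det_mulmx; ring.
Qed.

End RiemannianDistance.

(** * Nonpositive curvature *)

Section ExponentialMetricIncreasing.
Local Open Scope sesquilinear_scope.
Local Open Scope complex_scope.
Local Open Scope classical_set_scope.
Variables (R : realType) (d : nat).
Local Notation C := R[i].
Implicit Types (a b x : 'I_d -> R) (A B V Y : 'M[C]_d).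

Lemma rho_halving_iter (A B : R -> 'M[C]_d) n :
  (forall s, posdefmx (A s)) -> (forall s, posdefmx (B s)) ->
  (forall s, A s *m A s = A (2 * s)) -> (forall s, B s *m B s = B (2 * s)) ->
  4 ^+ n * rho (A (2^-1 ^+ n)) (B (2^-1 ^+ n)) ^+ 2 <= rho (A 1) (B 1) ^+ 2.
Proof.
move=> hA hB AA BB; elim: n => [|n]; first by rewrite !expr0 mul1r.
apply: le_trans; have := rho_sqr (hA (2^-1 ^+ n.+1)) (hB (2^-1 ^+ n.+1)); rewrite AA BB.
have -> : 2 * 2^-1 ^+ n.+1 = 2^-1 ^+ n :> R by rewrite exprS mulrA divff// mul1r.
by move=> h; rewrite exprSr -mulrA ler_wpM2l// exprn_ge0.
Qed.

(** This is [ln_sqr_ge] summed over the eigenvalues of [invmx A *m B]. As traces, the lower bound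
    can pass to the limit through the entries of [E]. *)
Lemma rho_sqr_ge_tr A B (e : R) (E := invmx A *m B - 1%:M) :
  posdefmx A -> posdefmx B -> 0 < e ->
  (1 - e) * complex.Re (\tr (E *m E)) - complex.Re (\tr (E *m E *m (E *m E))) / e
  <= rho A B ^+ 2.
Proof.
move=> hA hB e0; have [x x0 ABx] := posdef_rdiagonalized hA hB.
rewrite (rhoE hA hB ABx).
have [Y Yu YE] := rdiagonalized_affine (-1) 1 ABx.
have EE : E = invmx Y *m rdiag (fun i => -1 + 1 * x i) *m Y.
  by rewrite -YE rmorph1 scale1r addrC rmorphN1 -scalemx1 scaleN1r.
have E2 := rdiagonalizedM Yu EE EE.
have E4 := rdiagonalizedM Yu E2 E2.
rewrite (tr_rdiagonalized (ex_intro2 _ _ Y Yu E4)).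
rewrite (tr_rdiagonalized (ex_intro2 _ _ Y Yu E2)).
rewrite /= mulr_sumr mulr_suml -sumrB; apply: ler_sum => i _.
have := ln_sqr_ge (x0 i) e0; congr (_ <= _).
by rewrite mul1r; ring.
Qed.

Lemma cvg_half : (fun n : nat => 2^-1 ^+ n : R) @ \oo --> (0 : R).
Proof. by apply: cvg_expr; rewrite ger0_norm ?invr_ge0// invf_lt1// ltr1n. Qed.

Lemma half_cvg_le (u w : nat -> R) (l k D : R) :
  u @ \oo --> l -> w @ \oo --> k ->
  (forall n, (1 - 2^-1 ^+ n) * u n - 2^-1 ^+ n * w n <= D) -> l <= D.
Proof.
move=> ul wk le_D.
have L : (fun n => (1 - 2^-1 ^+ n) * u n - 2^-1 ^+ n * w n) @ \oo -->
    (1 - 0) * l - 0 * k.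
  apply: cvgB; apply: cvgM => //; try exact: cvg_half.
  by apply: cvgB; [exact: cvg_cst|exact: cvg_half].
rewrite subr0 mul1r mul0r subr0 in L.
rewrite -(cvg_lim _ L)//; apply: limr_le; first by apply/cvg_ex; exists l.
by near=> n; apply: le_D.
Unshelve. all: by end_near. Qed.

Lemma cvg_expR_half (c : R) :
  (fun n : nat => expR (2^-1 ^+ n * c)) @ \oo --> (1 : R).
Proof.
have h : (fun n : nat => 2^-1 ^+ n * c) @ \oo --> (0 * c : R).
  by apply: cvgM; [exact: cvg_half|exact: cvg_cst].
rewrite -[X in _ --> X](_ : expR (0 * c) = 1); last by rewrite mul0r expR0.
exact: (cvg_comp _ _ h (@continuous_expR R (0 * c))).
Qed.

Lemma cvg_expR_slope (c : R) :
  (fun n : nat => (expR (2^-1 ^+ n * c) - 1) / 2^-1 ^+ n) @ \oo --> c.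
Proof.
have s0 n : 0 < 2^-1 ^+ n :> R by rewrite exprn_gt0// invr_gt0.
apply: (@squeeze_cvgr _ _ _ _ (fun=> c) (fun n => c * expR (2^-1 ^+ n * c))).
- near=> n; have := s0 n; set s := _ ^+ n => sn0.
  rewrite ler_pdivlMr// ler_pdivrMr//; apply/andP; split.
    by have := expR_ge1Dx (s * c); rewrite [c * s]mulrC; lra.
  have := expR_ge1Dx (- (s * c)); rewrite expRN.
  have e0 := expR_gt0 (s * c); rewrite -(ler_pM2r e0) mulVf ?gt_eqF//.
  lra.
- exact: cvg_cst.
- rewrite -[X in _ --> X]mulr1; apply: cvgM; [exact: cvg_cst|].
  exact: cvg_expR_half.
Unshelve. all: by end_near. Qed.

Lemma scalec_sqr (c : R) (F : 'M[C]_d) :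
  (c%:C *: F) *m (c%:C *: F) = (c ^+ 2)%:C *: (F *m F).
Proof. by rewrite -scalemxAl -scalemxAr scalerA -rmorphM. Qed.

Lemma Re_trZ (c : R) (F : 'M[C]_d) :
  complex.Re (\tr (c%:C *: F)) = c * complex.Re (\tr F).
Proof.
by rewrite mxtraceZ; case: (\tr F) => u v /=; rewrite mul0r subr0.
Qed.

(* Halving reduces the claim to small multiples of the exponents, for which
   both sides agree to first order. *)
Lemma exp_metric_increasing a b V (K := V^t* *m rdiag b *m V - rdiag a) :
  V \in unitmx -> V^t* = invmx V ->
  complex.Re (\tr (K *m K)) <=
  rho (rdiag (fun i => expR (a i))) (V^t* *m rdiag (fun i => expR (b i)) *m V) ^+ 2.
Proof.
move=> Vu VV.
pose A s := rdiag (fun i => expR (s * a i)).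
pose B s := V^t* *m rdiag (fun i => expR (s * b i)) *m V.
have hA s : posdefmx (A s) by apply/posdef_rdiag => i; apply: expR_gt0.
have hB s : posdefmx (B s) by apply: posdef_gram_rdiag => // i; apply: expR_gt0.
have AA s : A s *m A s = A (2 * s).
  by rewrite /A rdiagM; apply: eq_rdiag => i; rewrite -expRD; congr expR; ring.
have BB s : B s *m B s = B (2 * s).
  rewrite /B VV (rdiagonalizedM Vu erefl erefl).
  rewrite (@eq_rdiag _ _ _ (fun i => expR (2 * s * b i)))// => i.
  by rewrite -expRD; congr expR; ring.
have A1 : A 1 = rdiag (fun i => expR (a i)).
  by apply: eq_rdiag => i; rewrite mul1r.
pose b1 i := expR (b i).
have B1 : B 1 = V^t* *m rdiag (fun i => expR (b i)) *m V.
  by rewrite /B (@eq_rdiag _ _ _ b1)// => i; rewrite mul1r.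
rewrite -A1 -B1.
pose s (n : nat) : R := 2^-1 ^+ n.
have s0 n : 0 < s n by rewrite exprn_gt0// invr_gt0.
pose k (c : 'I_d -> R) n i := (expR (s n * c i) - 1) / s n.
(* [F n] is (A(s)^-1 B(s) - 1) / s at s = [s n], written so that its limit is visible: the first
   factor tends to 1 and the slopes [k b n], [k a n] tend to [b] and [a]. *)
pose F n := rdiag (fun i => expR (s n * - a i)) *m
  (V^t* *m rdiag (k b n) *m V - rdiag (k a n)).
have FE n : invmx (A (s n)) *m B (s n) - 1%:M = (s n)%:C *: F n.
  rewrite invmx_rdiag => [|i]; last by rewrite gt_eqF// expR_gt0.
  rewrite /F scalemxAr scalerBr scalemxAl scalemxAr !rdiagZ.
  have kE c : rdiag (fun i => s n * k c n i) =
      rdiag (fun i => expR (s n * c i)) - 1%:M.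
    rewrite -rdiag1 -scaleN1r -[-1](rmorphN1 (real_complex R)) rdiagZ rdiagD.
    by apply: eq_rdiag => i; rewrite /k mulrC divfK ?mulr1// gt_eqF.
  have -> : V^t* *m rdiag (fun i => s n * k b n i) *m V = B (s n) - 1%:M.
    by rewrite kE mulmxBr mulmxBl mulmx1 VV (mulVmx Vu) /B VV.
  rewrite kE opprB addrA subrK mulmxBr rdiagM.
  have -> : rdiag (fun i => expR (s n * - a i) * expR (s n * a i)) = 1%:M.
    rewrite -rdiag1; apply: eq_rdiag => i.
    by rewrite mulrN -expRD addNr expR0.
  have -> // : rdiag (fun i => expR (s n * - a i)) =
      rdiag (fun i => (expR (s n * a i))^-1).
  by apply: eq_rdiag => i; rewrite mulrN expRN.
(* [rho_sqr_ge_tr] is used with [e = s n]: after division by s^2 both the loss e and the quartic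
   term s^4 / e contribute O(s). *)
have lo n : (1 - s n) * complex.Re (\tr (F n *m F n))
    - s n * complex.Re (\tr (F n *m F n *m (F n *m F n))) <= rho (A 1) (B 1) ^+ 2.
  apply: le_trans (rho_halving_iter n hA hB AA BB).
  have := rho_sqr_ge_tr (hA (s n)) (hB (s n)) (s0 n); rewrite FE.
  rewrite !scalec_sqr !Re_trZ -/(s n).
  have -> : 4 ^+ n = (s n ^+ 2)^-1.
    have -> : 4 = 2 ^+ 2 :> R by ring.
    by rewrite /s !exprVn invrK -!exprM mulnC.
  move: (s0 n) (complex.Re _) (complex.Re _) (rho _ _ ^+ 2) => sn0 u v w h.
  rewrite [leRHS]mulrC ler_pdivlMr ?exprn_gt0//; apply: le_trans h.
  rewrite le_eqVlt; apply/orP; left; apply/eqP; field; by rewrite gt_eqF.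
have Fcvg : mxcvg \oo F K.
  rewrite -[K]mul1mx -rdiag1; apply: mxcvgM.
    apply: mxcvg_rdiag => i; exact: cvg_expR_half.
  apply: mxcvgD; last first.
    by apply: mxcvgN; apply: mxcvg_rdiag => i; exact: cvg_expR_slope.
  apply: mxcvgM; last exact: mxcvg_cst.
  apply: mxcvgM; first exact: mxcvg_cst.
  by apply: mxcvg_rdiag => i; exact: cvg_expR_slope.
have FF : mxcvg \oo (fun n => F n *m F n) (K *m K) by apply: mxcvgM.
have [F2 _] : ccvg \oo (fun n => \tr (F n *m F n)) (\tr (K *m K)).
  exact: ccvg_mxtrace.
have [F4 _] : ccvg \oo (fun n => \tr (F n *m F n *m (F n *m F n)))
    (\tr (K *m K *m (K *m K))).
  by apply: ccvg_mxtrace; apply: mxcvgM.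
exact: half_cvg_le F2 F4 lo.
Qed.

End ExponentialMetricIncreasing.

(** * The curvature inequality along geodesics *)

Section NonpositiveCurvature.
Local Open Scope sesquilinear_scope.
Local Open Scope complex_scope.
Variables (R : realType) (d : nat).
Local Notation C := R[i].
Implicit Types (x y k : 'I_d -> R) (A B X Y M V : 'M[C]_d).

Lemma Re_tr_sqrD (c : R) (K L T : 'M[C]_d) : K = L + c%:C *: T ->
  complex.Re (\tr (K *m K)) =
  complex.Re (\tr (L *m L)) + 2 * c * complex.Re (\tr (L *m T))
  + c ^+ 2 * complex.Re (\tr (T *m T)).
Proof.
move=> ->; rewrite mulmxDl !mulmxDr scalec_sqr -scalemxAl -scalemxAr.
move: (L *m L) (L *m T) (T *m L) (T *m T) (mxtrace_mulC T L) => M1 M2 M3 M4 E.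
rewrite !mxtraceD !complex_ReD !Re_trZ E.
by move: (complex.Re _) (complex.Re _) (complex.Re _) => u v w; ring.
Qed.

Lemma posdef_exp Y : posdefmx Y -> exists V, exists2 y,
  V \in unitmx /\ V^t* = invmx V & Y = V^t* *m rdiag (fun i => expR (y i)) *m V.
Proof.
move=> /posdef_spectral[YE Y0].
exists (spectralmx Y), (fun i => ln (eigenvalues Y i)).
  by split; [exact: spectral_unit|exact: spectral_ctmx].
rewrite {1}YE; have -> // : rdiag (eigenvalues Y) =
  rdiag (fun i => expR (ln (eigenvalues Y i))).
by apply: eq_rdiag => i; rewrite lnK ?posrE.
Qed.

Lemma congr_invmxK X Y : X \in unitmx ->
  Y = X^t* *m ((invmx X)^t* *m Y *m invmx X) *m X.
Proof.
move=> Xu; have Xu' : X^t* \in unitmx by rewrite ctmx_unit.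
by rewrite ctmxV !mulmxA (mulmxV Xu') mul1mx (mulmxKV Xu).
Qed.

Lemma tr_gram_sqr V y : V \in unitmx -> V^t* = invmx V ->
  complex.Re (\tr ((V^t* *m rdiag y *m V) *m (V^t* *m rdiag y *m V))) =
  \sum_i y i ^+ 2.
Proof.
move=> Vu VV; rewrite VV.
have := rdiagonalizedM Vu (erefl (invmx V *m rdiag y *m V)) erefl.
move=> E; rewrite E (tr_rdiagonalized (ex_intro2 _ _ V Vu erefl))/=.
by apply: eq_bigr => i _; rewrite expr2.
Qed.

(** With L = log Y, the metric increasing property gives rho(e^(c k), Y)^2 >= ||L - c k||^2 for c =
    - t and c = 1 - t, and the left-hand side is exactly ||L||^2. What remains is the Euclidean
    identity (1 - t) ||L + t k||^2 + t ||L - (1 - t) k||^2 = ||L||^2 + t (1 - t) ||k||^2. *)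
Lemma rho_npc_diag Y k (t : R) : posdefmx Y -> 0 <= t <= 1 ->
  rho (1%:M) Y ^+ 2 <=
  (1 - t) * rho (rdiag (fun i => expR (- t * k i))) Y ^+ 2 +
  t * rho (rdiag (fun i => expR ((1 - t) * k i))) Y ^+ 2
  - t * (1 - t) * \sum_i k i ^+ 2.
Proof.
move=> hY /andP[t0 t1]; have [V [y [Vu VV] YE]] := posdef_exp hY.
have -> : rho 1%:M Y ^+ 2 = \sum_i y i ^+ 2.
  have -> : 1%:M = V^t* *m rdiag (fun=> 1) *m V.
    by rewrite rdiag1 mulmx1 VV (mulVmx Vu).
  rewrite YE rho_gram// => [|i]; last exact: expR_gt0.
  by apply: eq_bigr => i _; rewrite ln1 subr0 expRK.
pose L := V^t* *m rdiag y *m V.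
have trL : complex.Re (\tr (L *m L)) = \sum_i y i ^+ 2 := tr_gram_sqr y Vu VV.
have trk : complex.Re (\tr (rdiag k *m rdiag k)) = \sum_i k i ^+ 2.
  by rewrite rdiagM tr_rdiag/=; apply: eq_bigr => i _; rewrite expr2.
pose z : R := complex.Re (\tr (L *m rdiag k)).
have emi c : \sum_i y i ^+ 2 + 2 * (- c) * z + (- c) ^+ 2 * \sum_i k i ^+ 2 <=
    rho (rdiag (fun i => expR (c * k i))) Y ^+ 2.
  rewrite YE; apply: le_trans (exp_metric_increasing (fun i => c * k i) y Vu VV).
  rewrite -trL -trk le_eqVlt; apply/orP; left; apply/eqP/esym.
  by apply: Re_tr_sqrD; rewrite rmorphN scaleNr rdiagZ.
have := emi (- t); have := emi (1 - t).
clearbody z; move: (\sum_i y i ^+ 2) (\sum_i k i ^+ 2) => a b {emi}.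
move: (rho _ _ ^+ 2) (rho _ _ ^+ 2) => u v h2 h1.
have s0 : 0 <= 1 - t by rewrite subr_ge0.
have := ler_wpM2l s0 h1; have := ler_wpM2l t0 h2; lra.
Qed.

(* By congruence the point at parameter t is 1, and A, B are diagonal with
   logarithms - t k and (1 - t) k. *)
Lemma rho_npc A B Y (t : R) : posdefmx A -> posdefmx B -> posdefmx Y ->
  0 <= t <= 1 -> rho Y (mx_geodesic A B t) ^+ 2 <=
  (1 - t) * rho Y A ^+ 2 + t * rho Y B ^+ 2 - t * (1 - t) * rho A B ^+ 2.
Proof.
move=> hA hB hY t01.
have [X [x [Xu x0] [AE BE ME]]] := posdef_simdiag hA hB.
pose k i := ln (x i).
(* The square of [D] has entries x_i^t, so that W^* W is the geodesic point at parameter [t]. *)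
pose D := rdiag (fun i => expR (t / 2 * k i)).
have Du : D \in unitmx by apply: rdiag_unit => i; rewrite gt_eqF// expR_gt0.
pose W := D *m X.
have Wu : W \in unitmx by rewrite unitmx_mul Du.
have WE f g : (forall i, expR (t / 2 * k i) * f i * expR (t / 2 * k i) = g i) ->
    X^t* *m rdiag g *m X = W^t* *m rdiag f *m W.
  move=> /eq_rdiag <-.
  by rewrite /W ctmxM ctmx_rdiag !mulmxA -!(mulmxA (X^t*)) /D !rdiagM.
have exp2 c i : expR (t / 2 * k i) * expR (c * k i) * expR (t / 2 * k i) =
    expR ((t + c) * k i).
  by rewrite -!expRD; congr expR; field.
have M1 : mx_geodesic A B t = W^t* *m 1%:M *m W.
  rewrite -rdiag1 ME; apply: WE => i.
  by rewrite /powR gt_eqF// mulr1 -expRD; congr expR; rewrite /k; field.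
have AW : A = W^t* *m rdiag (fun i => expR (- t * k i)) *m W.
  have AE' : A = X^t* *m rdiag (fun=> 1) *m X by rewrite rdiag1 mulmx1.
  by rewrite [LHS]AE'; apply: WE => i; rewrite exp2 subrr mul0r expR0.
have BW : B = W^t* *m rdiag (fun i => expR ((1 - t) * k i)) *m W.
  rewrite [LHS]BE; apply: WE => i.
  by rewrite exp2 subrKC mul1r /k lnK ?posrE.
pose Z := invmx W.
have Zu : Z \in unitmx by rewrite unitmx_inv.
pose Y' := Z^t* *m Y *m Z.
have hY' : posdefmx Y' by apply: posdef_congr.
have YW : Y = W^t* *m Y' *m W.
  exact: congr_invmxK.
have he c : posdefmx (rdiag (fun i => expR (c * k i))).
  by apply/posdef_rdiag => i; apply: expR_gt0.
have congrW N M : posdefmx N -> M = W^t* *m N *m W -> rho Y M = rho N Y'.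
  by move=> hN ->; rewrite {1}YW (rho_congr Wu hY' hN) (rho_sym hY' hN).
have ABk : rho A B ^+ 2 = \sum_i k i ^+ 2.
  rewrite [A]AW [B]BW rho_gram// => [|i|i]; try exact: expR_gt0.
  by apply: eq_bigr => i _; rewrite !expRK; congr (_ ^+ 2); ring.
rewrite ABk (congrW _ _ (posdef1 R d) M1) (congrW _ _ (he _) AW).
rewrite (congrW _ _ (he _) BW); exact: rho_npc_diag.
Qed.

End NonpositiveCurvature.

(** * Completeness *)

Section Completeness.
Local Open Scope sesquilinear_scope.
Local Open Scope complex_scope.
Local Open Scope classical_set_scope.
Variables (R : realType) (d : nat).
Local Notation C := R[i].
Implicit Types (x : 'I_d -> R) (A B X Y : 'M[C]_d) (v : 'cV[C]_d).

Definition quadform A v : R := complex.Re ((v^t* *m A *m v) 0 0).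

Lemma quadform_gram_rdiag X x v :
  quadform (X^t* *m rdiag x *m X) v =
  \sum_i x i * ComplexField.Normc.normc ((X *m v) i 0) ^+ 2.
Proof.
rewrite /quadform; have -> : v^t* *m (X^t* *m rdiag x *m X) *m v =
    (X *m v)^t* *m rdiag x *m (X *m v) by rewrite ctmxM !mulmxA.
move: (X *m v) => w; apply: (@complexI R).
have -> : (w^t* *m rdiag x *m w) 0 0 =
    (\sum_i x i * ComplexField.Normc.normc (w i 0) ^+ 2)%:C; last by [].
rewrite /rdiag mul_mx_diag mxE rmorph_sum; apply: eq_bigr => i _.
by rewrite !mxE rmorphM rmorphXn/= -[_%:C ^+ 2]/(`|w i 0| ^+ 2) normCK; ring.
Qed.

(** Each |ln x_i| is at most [rho A B]. The conclusion is the Loewner order between multiples of [A]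
    and [B], tested on vectors. *)
Lemma quadform_bounds A B (r : R) v : posdefmx A -> posdefmx B ->
  rho A B <= r ->
  expR (- r) * quadform A v <= quadform B v <= expR r * quadform A v.
Proof.
move=> hA hB ABr; have [X [x [Xu x0] [AE BE _]]] := posdef_simdiag hA hB.
have AE' : A = X^t* *m rdiag (fun=> 1) *m X by rewrite rdiag1 mulmx1.
have lr i : `|ln (x i)| <= r.
  apply: le_trans ABr; rewrite -(ger0_norm (rho_ge0 A B)) -!sqrtr_sqr ler_wsqrtr//.
  rewrite AE' BE rho_gram// (bigD1 i)//= ln1 subr0 lerDl.
  by apply: sumr_ge0 => j _; apply: sqr_ge0.
rewrite [in quadform A]AE' [in quadform B]BE !quadform_gram_rdiag !mulr_sumr.
apply/andP; split; apply: ler_sum => i _; rewrite mulrA ler_wpM2r ?sqr_ge0// mulr1.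
  rewrite -[leRHS](@lnK _ (x i)) ?posrE// ler_expR.
  by have := lr i; rewrite ler_norml => /andP[].
rewrite -[leLHS](@lnK _ (x i)) ?posrE// ler_expR.
by have := lr i; rewrite ler_norml => /andP[].
Qed.

(** Converse of [quadform_bounds] up to the dimension: the vectors X^-1 e_i isolate the eigenvalues
    x_i. *)
Lemma rho_quadform A B (r : R) : posdefmx A -> posdefmx B ->
  (forall v, expR (- r) * quadform A v <= quadform B v <= expR r * quadform A v) ->
  rho A B <= d%:R * `|r|.
Proof.
move=> hA hB ABr; have [X [x [Xu x0] [AE BE _]]] := posdef_simdiag hA hB.
have AE' : A = X^t* *m rdiag (fun=> 1) *m X by rewrite rdiag1 mulmx1.
have lr i : ln (x i) ^+ 2 <= r ^+ 2.
  have := ABr (invmx X *m delta_mx i 0); rewrite AE' BE !quadform_gram_rdiag.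
  rewrite (mulKVmx Xu).
  have E y : \sum_j y j * ComplexField.Normc.normc ((delta_mx i 0 : 'cV[C]_d) j 0) ^+ 2
      = y i.
    rewrite (bigD1 i)//= big1 => [|j ji].
       by rewrite mxE !eqxx ComplexField.Normc.normc1 expr1n mulr1 addr0.
    by rewrite mxE (negbTE ji) ComplexField.Normc.normc0 expr0n mulr0.
  rewrite !E !mulr1 => /andP[h1 h2].
  have l1 : - r <= ln (x i) by rewrite -ler_expR lnK ?posrE.
  have l2 : ln (x i) <= r by rewrite -ler_expR lnK ?posrE.
  have r0 : 0 <= r by lra.
  by rewrite -real_normK ?num_real// ler_sqr ?nnegrE// ler_norml l1.
rewrite -ler_sqr ?nnegrE ?rho_ge0 ?mulr_ge0//.
rewrite {1}AE' BE rho_gram// exprMn real_normK ?num_real//.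
apply: (@le_trans _ _ (\sum_(i < d) r ^+ 2)).
  by apply: ler_sum => i _; rewrite ln1 subr0.
rewrite sumr_const card_ord -[leLHS]mulr_natl ler_wpM2r ?sqr_ge0//.
by rewrite -natrX ler_nat; case: (d) => // n; rewrite leq_pmulr.
Qed.

Lemma mulmx_expand (K : comNzRingType) n (x y : 'rV[K]_n) M (v w : 'cV[K]_n) :
  (x + y) *m M *m (v + w) =
  x *m M *m v + x *m M *m w + (y *m M *m v + y *m M *m w).
Proof. by rewrite !mulmxDl !mulmxDr. Qed.

Lemma quadform_add A v w : A^t* = A ->
  quadform A (v + w) = quadform A v + quadform A w
    + 2 * complex.Re ((v^t* *m A *m w) 0 0).
Proof.
move=> Ah; rewrite /quadform.
have -> : (v + w)^t* = v^t* + w^t*.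
  by apply/matrixP => i j; rewrite !mxE rmorphD.
have cross : (w^t* *m A *m v) 0 0 = Num.conj ((v^t* *m A *m w) 0 0).
  transitivity ((v^t* *m A *m w)^t* 0 0); first by rewrite !ctmxM trmxCK Ah mulmxA.
  by move: (v^t* *m A *m w) => N; rewrite !mxE.
rewrite mulmx_expand; move: cross.
move: (v^t* *m A *m v) (v^t* *m A *m w) (w^t* *m A *m v) (w^t* *m A *m w).
move=> a b c e cross; rewrite !mxE cross.
case: (a 0 0) (b 0 0) (e 0 0) => [a1 a2] [b1 b2] [e1 e2] /=; ring.
Qed.

Lemma entry_delta A (c e : C) i j :
  ((c *: delta_mx i 0 : 'cV[C]_d)^t* *m A *m (e *: delta_mx j 0 : 'cV[C]_d)) 0 0 =
  Num.conj c * e * A i j.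
Proof.
rewrite mxE (bigD1 j)//= big1 => [|l lj]; last first.
  by rewrite !mxE (negbTE lj)/= !mulr0.
rewrite addr0 mxE (bigD1 i)//= big1 => [|l li]; last first.
  by rewrite !mxE (negbTE li)/= mulr0 rmorph0 mul0r.
by rewrite addr0 !mxE !eqxx/= !mulr1; ring.
Qed.

(** Polarisation: convergence of all quadratic forms gives convergence of the entries. *)
Lemma Re_polar A i j : A^t* = A ->
  complex.Re (A i j) = 2^-1 * (quadform A (delta_mx i 0 + delta_mx j 0)
    - quadform A (delta_mx i 0) - quadform A (delta_mx j 0)).
Proof.
move=> Ah; rewrite quadform_add//.
have := entry_delta A 1 1 i j; rewrite !scale1r rmorph1 !mul1r => ->.
by field.
Qed.

Lemma Im_polar A i j : A^t* = A ->
  complex.Im (A i j) = - 2^-1 * (quadform A (delta_mx i 0 + 'i *: delta_mx j 0)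
    - quadform A (delta_mx i 0) - quadform A ('i *: delta_mx j 0)).
Proof.
move=> Ah; rewrite quadform_add//.
have := entry_delta A 1 'i i j; rewrite !scale1r rmorph1 !mul1r => ->.
have -> : complex.Re ('i * A i j) = - complex.Im (A i j).
  by rewrite mulrC ReiNIm.
by field.
Qed.

(** Along a Cauchy sequence the quadratic forms converge by [quadform_bounds], hence so do the
    entries by polarisation. The Loewner bounds survive in the limit; they make it positive definite
    and, through [rho_quadform], a limit for [rho]. *)
Lemma rho_complete (u : nat -> 'M[C]_d) : (forall n, posdefmx (u n)) ->
  (forall e : R, 0 < e -> exists N, forall n k, (N <= n)%N -> (N <= k)%N ->
     rho (u n) (u k) <= e) ->
  exists2 l, posdefmx l & forall e : R, 0 < e -> exists N, forall n, (N <= n)%N ->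
     rho (u n) l <= e.
Proof.
move=> hu cau.
have q0 n v : 0 <= quadform (u n) v.
  have [X [x [Xu x0] [AE BE _]]] := posdef_simdiag (hu n) (hu n).
  rewrite BE quadform_gram_rdiag; apply: sumr_ge0 => i _.
  by rewrite mulr_ge0 ?sqr_ge0// ltW.
have [N1 hN1] := cau 1 ltr01.
have qcvg v : cvg ((fun n => quadform (u n) v) @ \oo).
  apply: cauchy_cvg; apply/cauchy_exP => e e0.
  pose K := expR 1 * quadform (u N1) v + 1.
  have K0 : 0 < K by rewrite ltr_wpDl// mulr_ge0// expR_ge0.
  have K1 n : (N1 <= n)%N -> quadform (u n) v < K.
    move=> N1n.
    have /andP[_ h] := quadform_bounds v (hu N1) (hu n) (hN1 _ _ (leqnn _) N1n).
    by rewrite /K ltr_pwDr.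
  have eK0 : 0 < e / K by rewrite divr_gt0.
  (* The factor [1 + e / K] changes a form of value below [K] by less than [e]. *)
  have r0 : 0 < ln (1 + e / K) by rewrite ln_gt0// ltrDl.
  have [N hN] := cau _ r0.
  pose n0 := maxn N N1; exists (quadform (u n0) v).
  exists n0 => // n /= n0n; rewrite /ball/=.
  have Nn : (N <= n)%N by rewrite (leq_trans _ n0n)// leq_maxl.
  have N1n : (N1 <= n)%N by rewrite (leq_trans _ n0n)// leq_maxr.
  have Nn0 : (N <= n0)%N by rewrite leq_maxl.
  have N1n0 : (N1 <= n0)%N by rewrite leq_maxr.
  have one k l : (N <= k)%N -> (N <= l)%N -> (N1 <= k)%N ->
      quadform (u l) v - quadform (u k) v < e.
    move=> Nk Nl N1k.
    have /andP[_] := quadform_bounds v (hu k) (hu l) (hN _ _ Nk Nl).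
    rewrite lnK ?posrE ?addr_gt0// mulrDl mul1r -lerBlDl => h.
    apply: le_lt_trans h _.
    by rewrite mulrAC ltr_pdivrMr// ltr_pM2l// K1.
  rewrite ltr_norml; apply/andP; split; last exact: one.
  by rewrite -ltrN2 opprB opprK; exact: one.
have Recvg i j : cvg ((fun n => complex.Re (u n i j)) @ \oo).
  under eq_fun do rewrite (Re_polar _ _ (posdef_herm (hu _))).
  by apply: is_cvgM; [exact: is_cvg_cst|apply: is_cvgB; [apply: is_cvgB|]].
have Imcvg i j : cvg ((fun n => complex.Im (u n i j)) @ \oo).
  under eq_fun do rewrite (Im_polar _ _ (posdef_herm (hu _))).
  by apply: is_cvgM; [exact: is_cvg_cst|apply: is_cvgB; [apply: is_cvgB|]].
pose L : 'M[C]_d := \matrix_(i, j)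
  Complex (lim ((fun n => complex.Re (u n i j)) @ \oo))
          (lim ((fun n => complex.Im (u n i j)) @ \oo)).
have uL : mxcvg \oo u L by move=> i j; rewrite mxE; split; rewrite /=.
have qL v : ccvg \oo (fun n => (v^t* *m u n *m v) 0 0) ((v^t* *m L *m v) 0 0).
  suff : mxcvg \oo (fun n => v^t* *m u n *m v) (v^t* *m L *m v) by apply.
  by apply: mxcvgM; [apply: mxcvgM => //|]; exact: mxcvg_cst.
have bound r v n (N : nat) : (forall k, (N <= k)%N -> rho (u n) (u k) <= r) ->
    expR (- r) * quadform (u n) v <= quadform L v <= expR r * quadform (u n) v.
  move=> hr; have [qv _] := qL v.
  have b k : (N <= k)%N -> expR (- r) * quadform (u n) v <= quadform (u k) v
      <= expR r * quadform (u n) v.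
    by move=> Nk; apply: quadform_bounds => //; apply: hr.
  apply/andP; split.
    by apply: (cvgr_to_ge qv); exists N => // k /= /b /andP[].
  by apply: (cvgr_to_le qv); exists N => // k /= /b /andP[].
have hL : posdefmx L.
  split.
    rewrite hermsymmxE; apply/eqP/matrixP => i j.
    have uL' : mxcvg \oo u (L^t*).
      have -> : u = (fun n => (u n)^t*).
        by apply/funext => n; rewrite posdef_herm.
      exact: mxcvg_ctmx.
    have [[a1 a2] [b1 b2]] := (uL i j, uL' i j).
    apply/eqP; rewrite eq_complex; apply/andP; split; apply/eqP.
      exact: (cvg_unique _ b1 a1).
    exact: (cvg_unique _ b2 a2).
  move=> v v0; have [_ qi] := qL v.
  have uv n : (0 : C) < (v^t* *m u n *m v) 0 0 by case: (hu n) => _; apply.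
  rewrite ltcE; apply/andP; split.
    apply/eqP; apply: (cvg_unique _ qi) => //=.
    have -> : (fun n => complex.Im ((v^t* *m u n *m v) 0 0)) = fun=> 0.
      by apply/funext => n; have := uv n; rewrite ltcE => /andP[/eqP -> _].
    exact: cvg_cst.
  (* A bound by e^-1 times the form of one fixed [u N1] keeps the limit from degenerating. *)
  have /andP[h _] := bound 1 v N1 N1 (fun k Nk => hN1 _ _ (leqnn _) Nk).
  apply: lt_le_trans h; rewrite mulr_gt0 ?expR_gt0//.
  by have := uv N1; rewrite ltcE => /andP[].
exists L => // e e0.
(* This absorbs the factor [d] of [rho_quadform]; the successor avoids a division by zero when
   [d = 0]. *)
have r0 : 0 < e / d.+1%:R by rewrite divr_gt0.
have [N hN] := cau _ r0; exists N => n Nn.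
have unL v := bound _ v n N (fun k Nk => hN _ _ Nn Nk).
apply: (le_trans (rho_quadform (hu n) hL unL)).
rewrite ger0_norm ?(ltW r0)// mulrCA ler_piMr ?(ltW e0)//.
by rewrite ler_pdivrMr// mul1r ler_nat.
Qed.

End Completeness.

(** * Lengths of paths *)

HB.lock Definition speed (R : realType) (d : nat) (f : R -> 'M[R[i]]_d) (t : R) : R :=
  frobenius_norm
    (powmx (f t) (- 2^-1) *m deriv_path f t *m powmx (f t) (- 2^-1)).

Section Paths.
Local Open Scope sesquilinear_scope.
Local Open Scope complex_scope.
Local Open Scope classical_set_scope.
Local Open Scope ring_scope.
Variables (R : realType) (d : nat).
Local Notation C := R[i].
Implicit Types (A B X : 'M[C]_d) (f g : R -> 'M[C]_d) (a b s t u e : R).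

Lemma rho_triangle A B X : posdefmx A -> posdefmx B -> posdefmx X ->
  rho A B <= rho X A + rho X B.
Proof.
apply: (@npc_triangle R _ (@posdefmx R d) (@rho R d) (@mx_geodesic R d)).
  exact: rho_ge0.
by move=> *; apply: rho_npc.
Qed.

Lemma path_lengthE a b f : path_length a b f = fine (int (speed f) a b).
Proof. by rewrite speed.unlock. Qed.

Lemma speed_ge0 f t : 0 <= speed f t.
Proof. by rewrite speed.unlock sqrtr_ge0. Qed.

(** The trace contains no square root of [f t], so continuity of the speed reduces to that of
    inverses and products. *)
Lemma speed_sqr f t : posdefmx (f t) -> speed f t ^+ 2 = complex.Re
  (\tr (invmx (f t) *m deriv_path f t *m invmx (f t) *m (deriv_path f t)^t*)).
Proof. by move=> ft; rewrite -(frobenius_congr _ ft) speed.unlock. Qed.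

Lemma speedE f t : posdefmx (f t) -> speed f t = Num.sqrt (complex.Re
  (\tr (invmx (f t) *m deriv_path f t *m invmx (f t) *m (deriv_path f t)^t*))).
Proof.
by move=> ft; rewrite -(speed_sqr ft) sqrtr_sqr ger0_norm// speed_ge0.
Qed.

Lemma fine_int_speed_ge0 f a b : 0 <= fine (int (speed f) a b).
Proof. by apply/fine_ge0/int_ge0 => x; apply: speed_ge0. Qed.

Lemma cvg_Re_tr (T : Type) (F : set_system T) (FF : Filter F)
    (A1 A2 A3 A4 : T -> 'M[C]_d) (B1 B2 B3 B4 : 'M[C]_d) :
  mxcvg F A1 B1 -> mxcvg F A2 B2 -> mxcvg F A3 B3 -> mxcvg F A4 B4 ->
  (fun p => complex.Re (\tr (A1 p *m A2 p *m A3 p *m (A4 p)^t*))) @ F -->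
  complex.Re (\tr (B1 *m B2 *m B3 *m B4^t*)).
Proof.
move=> h1 h2 h3 h4.
suff : ccvg F (fun p => \tr (A1 p *m A2 p *m A3 p *m (A4 p)^t*))
  (\tr (B1 *m B2 *m B3 *m B4^t*)) by case.
apply: ccvg_mxtrace; apply: mxcvgM; last exact: mxcvg_ctmx.
by apply: mxcvgM => //; apply: mxcvgM.
Qed.

Lemma Re_tr_scale2 (c : R) (M N Q : 'M[C]_d) :
  complex.Re (\tr (M *m (c%:C *: Q) *m N *m (c%:C *: Q)^t*)) =
  c ^+ 2 * complex.Re (\tr (M *m Q *m N *m Q^t*)).
Proof.
have -> : (c%:C *: Q)^t* = c%:C *: Q^t*.
  by apply/matrixP => i j; rewrite !mxE rmorphM/= conjC_real.
rewrite -(scalemxAr _ M) -!scalemxAl -scalemxAr scalerA -rmorphM -expr2.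
exact: Re_trZ.
Qed.

Lemma rho_sqr_le_scaled A B (c : R) (Q : 'M[C]_d) : posdefmx A -> posdefmx B ->
  B - A = c%:C *: Q ->
  rho A B ^+ 2 <= c ^+ 2 * complex.Re (\tr (invmx A *m Q *m invmx B *m Q^t*)).
Proof.
move=> hA hB; have Dh : (B - A)^t* = B - A.
  have := posdef_herm hA; have := posdef_herm hB.
  move=> /matrixP h2 /matrixP h1; apply/matrixP => i j.
  by have := h1 i j; have := h2 i j; rewrite !mxE rmorphB/= => -> ->.
move: (rho_sqr_le_tr hA hB) Dh; move: (B - A) (invmx A) (invmx B) => D M N h Dh DQ.
by apply: le_trans h _; rewrite -Re_tr_scale2 -DQ Dh.
Qed.

Section SmoothPath.
Variable g : R -> 'M[C]_d.
Hypothesis sg : smooth_path g.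

Let derivable_Re i j t : derivable (fun t => complex.Re (g t i j)) t 1.
Proof. by have [h _] := sg i j; apply: (h 0%N). Qed.

Let derivable_Im i j t : derivable (fun t => complex.Im (g t i j)) t 1.
Proof. by have [_ h] := sg i j; apply: (h 0%N). Qed.

Let continuous_derivable (h : R -> R) t : derivable h t 1 -> {for t, continuous h}.
Proof. by move=> /derivable1_diffP/differentiable_continuous. Qed.

Let continuous_dRe i j t :
  {for t, continuous (derive1 (fun t => complex.Re (g t i j)))}.
Proof. by have [h _] := sg i j; apply: continuous_derivable; apply: (h 1%N). Qed.

Let continuous_dIm i j t :
  {for t, continuous (derive1 (fun t => complex.Im (g t i j)))}.
Proof. by have [_ h] := sg i j; apply: continuous_derivable; apply: (h 1%N). Qed.

Lemma mxcvg_path (T : Type) (F : set_system T) {FF : Filter F} (x : T -> R) t :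
  x @ F --> t -> mxcvg F (fun p => g (x p)) (g t).
Proof.
move=> xt i j; split.
  have := continuous_derivable (@derivable_Re i j t).
  exact: (cvg_comp x (fun u => complex.Re (g u i j)) xt).
have := continuous_derivable (@derivable_Im i j t).
exact: (cvg_comp x (fun u => complex.Im (g u i j)) xt).
Qed.

Lemma mxcvg_deriv_path (T : Type) (F : set_system T) {FF : Filter F} (x : T -> R) t :
  x @ F --> t -> mxcvg F (fun p => deriv_path g (x p)) (deriv_path g t).
Proof.
move=> xt i j; rewrite /deriv_path mxE; under eq_fun do rewrite mxE.
split; first exact: (cvg_comp x _ xt (@continuous_dRe i j t)).
exact: (cvg_comp x _ xt (@continuous_dIm i j t)).
Qed.

Lemma speed_cvg (T : Type) (F : set_system T) {FF : Filter F} (x : T -> R) t :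
  x @ F --> t -> posdefmx (g t) -> (\forall p \near F, posdefmx (g (x p))) ->
  (fun p => speed g (x p)) @ F --> speed g t.
Proof.
move=> xt gt gx; rewrite (speedE gt).
have D : mxcvg F (fun p => deriv_path g (x p)) (deriv_path g t).
  exact: mxcvg_deriv_path.
have I : mxcvg F (fun p => invmx (g (x p))) (invmx (g t)).
  apply: mxcvg_invmx; [|exact: posdef_unit|exact: mxcvg_path].
  by apply: filterS gx => p /posdef_unit.
have H := cvg_Re_tr FF I D I D.
have {}H := cvg_comp _ _ H (@sqrt_continuous R _).
apply: cvg_trans H; apply: near_eq_cvg.
by apply: filterS gx => p gp; rewrite /= speedE.
Qed.

Variables a b : R.
Hypothesis pg : forall t, t \in `[a, b] -> posdefmx (g t).

Lemma within_speed : {within `[a, b], continuous (speed g)}.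
Proof.
apply/subspace_continuousP => t /= tab.
apply: (@speed_cvg _ _ _ id); [|exact: pg|].
  exact: cvg_within.
by rewrite near_withinE; apply: nearW => u /pg.
Qed.

Lemma speed_gt_near t e : t \in `[a, b] -> 0 < e -> exists2 r, 0 < r &
  forall u, u \in `[a, b] -> `|u - t| < r -> speed g t - e < speed g u.
Proof.
move=> tab e0.
have H : speed g @ within [set u | u \in `[a, b]] (nbhs t) --> speed g t.
  apply: (@speed_cvg _ _ _ id); [exact: cvg_within|exact: pg|].
  by rewrite near_withinE; apply: nearW => u /pg.
have se : speed g t - e < speed g t by rewrite ltrBlDr ltrDl.
have : \forall u \near within [set u | u \in `[a, b]] (nbhs t),
    speed g t - e < speed g u by exact: (cvgr_gt _ H).
rewrite near_withinE => /nbhs_ballP[r /= r0 h].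
exists r => // u uab ur; apply: (h u _ uab).
by rewrite -ball_normE/= distrC.
Qed.

(** With [Q] the difference quotient, [rho_sqr_le_scaled] bounds rho^2 / (u - s)^2 by a trace that
    tends to the squared speed when both end points tend to [t]. *)
Lemma rho_local t e : t \in `[a, b] -> 0 < e ->
  \forall p \near increasing_pairs a b t,
    rho (g p.1) (g p.2) <= (speed g t + e) * (p.2 - p.1).
Proof.
move=> tab e0; pose F := increasing_pairs a b t.
have pF : \forall p \near F, [/\ posdefmx (g p.1), posdefmx (g p.2) & p.1 < p.2].
  by rewrite near_withinE; apply: nearW => p [h1 h2 h3]; split=> //; exact: pg.
have c1 : (fun p : R * R => p.1) @ F --> t by apply: (@cvg_increasing_pairs1 _ a b t id).
have c2 : (fun p : R * R => p.2) @ F --> t by apply: (@cvg_increasing_pairs2 _ a b t id).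
pose Q (p : R * R) : 'M[C]_d := ((p.2 - p.1)^-1)%:C *: (g p.2 - g p.1).
have QD : mxcvg F Q (deriv_path g t).
  move=> i j; rewrite /Q /deriv_path mxE; under eq_fun do rewrite !mxE.
  have H1 := @cvg_slope R a b t _ (@derivable_Re i j) (@continuous_dRe i j t).
  have H2 := @cvg_slope R a b t _ (@derivable_Im i j) (@continuous_dIm i j t).
  split.
    under eq_fun do rewrite complex_ReM complex_ReB mul0r subr0.
    exact: H1.
  under eq_fun do rewrite complex_ImM complex_ImB mul0r addr0.
  exact: H2.
have I1 : mxcvg F (fun p => invmx (g p.1)) (invmx (g t)).
  apply: mxcvg_invmx; [|exact/posdef_unit/pg|exact: mxcvg_path].
  by apply: filterS pF => p [/posdef_unit].
have I2 : mxcvg F (fun p => invmx (g p.2)) (invmx (g t)).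
  apply: mxcvg_invmx; [|exact/posdef_unit/pg|exact: mxcvg_path].
  by apply: filterS pF => p [_ /posdef_unit].
have FF : Filter F by exact: increasing_pairs_filter.
have H := cvg_Re_tr FF I1 QD I2 QD.
have lt_sq : complex.Re (\tr (invmx (g t) *m deriv_path g t *m invmx (g t)
     *m (deriv_path g t)^t*)) < (speed g t + e) ^+ 2.
  rewrite -(speed_sqr (pg tab)).
  by rewrite ltr_sqr ?nnegrE ?addr_ge0 ?speed_ge0 ?(ltW e0)// ltrDl.
have {}H := @cvgr_lt _ _ _ FF _ _ H _ lt_sq.
apply: filterS (filterI pF H) => p [[p1 p2 p12] {}H].
have p0 : 0 < p.2 - p.1 by rewrite subr_gt0.
have se0 : 0 <= speed g t + e by rewrite addr_ge0 ?speed_ge0// ltW.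
rewrite -ler_sqr ?nnegrE ?rho_ge0 ?mulr_ge0// ?(ltW p0)//.
have gE : g p.2 - g p.1 = (p.2 - p.1)%:C *: Q p.
  by rewrite /Q scalerA -rmorphM divff ?gt_eqF// scale1r.
apply: le_trans (rho_sqr_le_scaled p1 p2 gE) _.
rewrite [leRHS]exprMn [leRHS]mulrC; apply: ler_wpM2l; first exact: sqr_ge0.
exact: ltW.
Qed.

(** The slack is taken proportional to the length of the interval, so that the estimate adds up
    under concatenation, by the triangle inequality, and [interval_induction] applies. *)
Lemma rho_le_length : a <= b -> rho (g a) (g b) <= fine (int (speed g) a b).
Proof.
move=> ab; have cs := within_speed.
have cs' s u : a <= s -> u <= b -> {within `[s, u], continuous (speed g)}.
  move=> sa ub; apply: continuous_subspaceW cs => x /=; rewrite !in_itv/=.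
  by move=> /andP[sx xu]; rewrite (le_trans sa)//= (le_trans xu).
have ps s : a <= s -> s <= b -> posdefmx (g s).
  by move=> sa sb; apply: pg; rewrite in_itv/= sa.
suff H e : 0 < e -> rho (g a) (g b) <= fine (int (speed g) a b) + e * (b - a).
  apply/ler_addgt0Pr => e e0.
  have [ba|ba] := leP b a.
    have -> : b = a by apply/eqP; rewrite eq_le ba.
    rewrite rho_refl; last exact: ps.
    by apply: addr_ge0; [exact: fine_int_speed_ge0|exact: ltW].
  have ba0 : 0 < b - a by rewrite subr_gt0.
  by have := H (e / (b - a)) (divr_gt0 e0 ba0); rewrite divfK ?gt_eqF.
move=> e0; pose P s u := rho (g s) (g u) <= fine (int (speed g) s u) + e * (u - s).
apply: (@interval_induction R P) => //.
  move=> s m u sa sm mu ub; rewrite /P => h1 h2.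
  rewrite (@fine_int_cat _ _ s m u)//; [|by move=> ?; apply: speed_ge0|exact: cs'].
  have sb : s <= b by rewrite (le_trans sm)// (le_trans mu).
  have am : a <= m by rewrite (le_trans sa).
  have mb : m <= b by rewrite (le_trans mu).
  have := rho_triangle (ps _ sa sb) (ps u (le_trans am mu) ub) (ps _ am mb).
  rewrite (rho_sym (ps _ am mb) (ps _ sa sb)); lra.
(* Half of [e] goes to [rho_local], the other half to bounding the speed below by
   [speed g t - e / 2] on a short interval. *)
move=> t tab; have e20 : 0 < e / 2 by rewrite divr_gt0.
have tab' : t \in `[a, b] by rewrite in_itv.
have := rho_local tab' e20; rewrite near_withinE => /nbhs_ballP[r1 /= r10 h1].
have [r2 r20 h2] := speed_gt_near tab' e20.
exists (Num.min r1 r2); first by rewrite lt_min r10.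
move=> s u sa; rewrite le_eqVlt => /predU1P[su|su] ub.
  move=> _ _; rewrite -su in ub *.
  rewrite /P rho_refl; last exact: ps.
  by rewrite subrr mulr0 addr0 fine_int_speed_ge0.
rewrite !lt_min => /andP[s1 s2] /andP[u1 u2].
have sb : s <= b by rewrite (le_trans (ltW su)).
have au : a <= u by rewrite (le_trans sa)// ltW.
have := h1 (s, u); rewrite /= => /(_ _ _)/le_trans; apply.
- by split; rewrite /= -ball_normE/= distrC.
- by split=> //; rewrite in_itv/= ?sa ?sb ?au ?ub.
have su0 : 0 < u - s by rewrite subr_gt0.
have [ms fs] := within_int_fin (cs' s u sa ub).
have : ((speed g t - e / 2) * (u - s) <= fine (int (speed g) s u)).
  rewrite -lee_fin fineK; last by rewrite ge0_fin_numE// int_ge0// => x; apply: speed_ge0.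
  apply: int_cst_le => //; [by move=> x; apply: speed_ge0|exact: ltW|].
  move=> x; rewrite in_itv/= => /andP[sx xu].
  apply/ltW/h2; first by rewrite in_itv/= (le_trans sa)//= (le_trans xu).
  move: s2 u2; rewrite !ltr_norml => /andP[k1 k2] /andP[k3 k4]; apply/andP; split; lra.
lra.
Qed.

End SmoothPath.

(** The interval is open because at an end point the derivative of [f] also depends on values
    outside the segment. *)
Lemma speed_eq f g a b t : {in `[a, b], f =1 g} -> t \in `]a, b[ ->
  speed f t = speed g t.
Proof.
move=> fg tab; have fgt : f t = g t by apply: fg; apply: subset_itv_oo_cc.
rewrite speed.unlock fgt; suff -> : deriv_path f t = deriv_path g t by [].
have near_fg : \forall u \near t, f u = g u.
  near=> u; apply: fg; apply: subset_itv_oo_cc; near: u.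
  exact: near_in_itvoo.
apply/matrixP => i j; rewrite !mxE !derive1E.
by congr (Complex _ _); apply: near_eq_derive;
  apply: filterS near_fg => u ->.
Unshelve. all: by end_near. Qed.

(** Induction on the break points with the triangle inequality. Measurability and finiteness are
    carried along because the integrals, and then their [fine] values, have to be added. *)
Lemma rho_le_piecewise_length f a (s : seq R) :
  path <%O a s ->
  (forall k : nat, (k < size s)%N ->
      exists2 g : R -> 'M[R[i]]_d, smooth_path g &
        {in `[nth a (a :: s) k, nth a s k], f =1 g}) ->
  (forall t, t \in `[a, last a s] -> posdefmx (f t)) ->
  [/\ a <= last a s, measurable_fun `[a, last a s] (speed f),
     (int (speed f) a (last a s) < +oo)%E &
     rho (f a) (f (last a s)) <= fine (int (speed f) a (last a s))].
Proof.
have s0 t : 0 <= speed f t by apply: speed_ge0.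
elim: s a => [|x s IH] a /=.
  move=> _ _ pf; split=> //; first by rewrite set_itv1; exact: measurable_fun_set1.
    by rewrite /int set_itv1 integral_set1.
  rewrite rho_refl; first exact: fine_int_speed_ge0.
  by apply: pf; rewrite in_itv/= lexx.
move=> /andP[ax xs] pieces pf.
have [g sg fg] := pieces 0%N isT; rewrite /= in fg.
have xl : x <= last x s.
  have := mem_last x s; rewrite inE => /predU1P[->//|].
  by move=> /(allP (order_path_min lt_trans xs)) /ltW.
have [k ks|t|_ m2 f2 r2] := IH x xs.
- have [g' sg' fg'] := pieces k.+1 ks; exists g' => //; move: fg'.
  rewrite /= (set_nth_default x) ?ltnS 1?ltnW//.
  by rewrite (set_nth_default x).
- rewrite in_itv/= => /andP[xt tl]; apply: pf; rewrite in_itv/= tl andbT.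
  by rewrite (le_trans (ltW ax)).
have pg t : t \in `[a, x] -> posdefmx (g t).
  move=> tax; rewrite -fg//; apply: pf; move: tax; rewrite !in_itv/=.
  by move=> /andP[-> tx]; rewrite (le_trans tx).
have [mg fing] := within_int_fin (within_speed sg pg).
have mg' : measurable_fun `]a, x[ (speed g).
  by apply: measurable_funS mg => //; apply: subset_itv_oo_cc.
have [m1 e1] := eq_int_oo mg' (fun t => @speed_eq f g a x t fg).
have al : a <= last x s by rewrite (le_trans (ltW ax)).
have [m12 ->] := int_cat s0 (ltW ax) xl m1 m2.
have aI : a \in `[a, x] by rewrite in_itv/= lexx ltW.
have xI : x \in `[a, x] by rewrite in_itv/= lexx ltW.
split=> //; first by rewrite e1 lte_add_pinfty.
rewrite fineD ?ge0_fin_numE ?e1 ?int_ge0//; try exact: speed_ge0.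
have xI' : x \in `[a, last x s] by rewrite in_itv/= xl ltW.
have [pa px pl] : [/\ posdefmx (f a), posdefmx (f x) & posdefmx (f (last x s))].
  by split; apply: pf; rewrite in_itv/= ?lexx ?al ?xl ?(ltW ax).
have := rho_le_length sg pg (ltW ax); rewrite -!fg//.
have := rho_triangle pa pl px; rewrite (rho_sym px pa); lra.
Qed.

Lemma rho_le_path_length A B a b f : path_connecting A B a b f ->
  rho A B <= path_length a b f.
Proof.
move=> [ab [s [sp /eqP sl] pieces] pf <- <-].
have [t|_ _ _] := rho_le_piecewise_length sp pieces.
  by rewrite sl => tab; apply: pf.
by rewrite path_lengthE sl.
Qed.

End Paths.

(** * Exponential paths, of constant speed *)

Section ExponentialPath.
Local Open Scope sesquilinear_scope.
Local Open Scope complex_scope.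
Local Open Scope classical_set_scope.
Local Open Scope ring_scope.
Variables (R : realType) (d : nat).
Local Notation C := R[i].
Implicit Types (A B X : 'M[C]_d) (c k : 'I_d -> R) (t : R).

(** Real and imaginary parts of the entries of [exp_path] have this form, which is stable under
    derivation; smoothness follows by induction on the order. *)
Definition expsum c k t : R := \sum_l c l * expR (t * k l).

Lemma is_derive_expsum c k t :
  is_derive t (1 : R) (expsum c k) (expsum (fun l => c l * k l) k t).
Proof.
have H l : is_derive t (1 : R) (fun u => c l * expR (u * k l))
    (c l * k l * expR (t * k l)).
  apply: is_derive_eq; rewrite /GRing.scale/=; ring.
have -> : expsum c k = \sum_l (fun u => c l * expR (u * k l)).
  by apply/funext => u; rewrite fct_sumE.
exact: is_derive_sum.
Qed.

Lemma derive1_expsum c k : derive1 (expsum c k) = expsum (fun l => c l * k l) k.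
Proof.
apply/funext => t; rewrite derive1E.
exact: (@derive_val _ _ _ _ _ _ _ (is_derive_expsum c k t)).
Qed.

Lemma derive1n_expsum n c k :
  exists c', derive1n n (expsum c k) = expsum c' k.
Proof.
elim: n => [|n [c' IH]]; first by exists c.
by exists (fun l => c' l * k l); rewrite derive1nS IH derive1_expsum.
Qed.

Lemma smooth_expsum c k : smooth (expsum c k).
Proof.
move=> n t; have [c' ->] := derive1n_expsum n c k.
exact: (@ex_derive _ _ _ _ _ _ _ (is_derive_expsum c' k t)).
Qed.

Variables (X : 'M[C]_d) (k : 'I_d -> R).
Hypothesis Xu : X \in unitmx.

Definition exp_path t : 'M[C]_d := X^t* *m rdiag (fun i => expR (t * k i)) *m X.

Lemma gram_rdiagE (x : 'I_d -> R) i j : (X^t* *m rdiag x *m X) i j =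
  \sum_l (x l)%:C * (Num.conj (X l i) * X l j).
Proof.
rewrite /rdiag mul_mx_diag mxE; apply: eq_bigr => l _.
by rewrite !mxE mulrAC mulrC.
Qed.

Let cRe i j l := complex.Re (Num.conj (X l i) * X l j).
Let cIm i j l := complex.Im (Num.conj (X l i) * X l j).

Lemma Re_gram_rdiag (x : 'I_d -> R) i j :
  complex.Re ((X^t* *m rdiag x *m X) i j) = \sum_l cRe i j l * x l.
Proof.
rewrite gram_rdiagE raddf_sum; apply: eq_bigr => l _.
by rewrite [LHS]complex_ReM mul0r subr0 mulrC.
Qed.

Lemma Im_gram_rdiag (x : 'I_d -> R) i j :
  complex.Im ((X^t* *m rdiag x *m X) i j) = \sum_l cIm i j l * x l.
Proof.
rewrite gram_rdiagE raddf_sum; apply: eq_bigr => l _.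
by rewrite [LHS]complex_ImM mul0r addr0 mulrC.
Qed.

Lemma Re_exp_path i j : (fun t => complex.Re (exp_path t i j)) = expsum (cRe i j) k.
Proof. by apply/funext => t; apply: Re_gram_rdiag. Qed.

Lemma Im_exp_path i j : (fun t => complex.Im (exp_path t i j)) = expsum (cIm i j) k.
Proof. by apply/funext => t; apply: Im_gram_rdiag. Qed.

Lemma smooth_exp_path : smooth_path exp_path.
Proof.
by move=> i j; rewrite Re_exp_path Im_exp_path; split; apply: smooth_expsum.
Qed.

Lemma deriv_exp_path t : deriv_path exp_path t =
  X^t* *m rdiag (fun i => k i * expR (t * k i)) *m X.
Proof.
apply/matrixP => i j; rewrite [LHS]mxE Re_exp_path Im_exp_path !derive1_expsum.
apply/eqP; rewrite eq_complex Re_gram_rdiag Im_gram_rdiag.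
by apply/andP; split; apply/eqP; apply: eq_bigr => l _; rewrite mulrA.
Qed.

Lemma posdef_exp_path t : posdefmx (exp_path t).
Proof. by apply: posdef_gram_rdiag => // i; apply: expR_gt0. Qed.

(** [invmx (exp_path t) *m deriv_path exp_path t] is similar to [rdiag k] for every [t]: the
    exponentials cancel. *)
Lemma speed_exp_path t : speed exp_path t ^+ 2 = \sum_i k i ^+ 2.
Proof.
rewrite (speed_sqr (posdef_exp_path t)) deriv_exp_path.
have -> : (X^t* *m rdiag (fun i => k i * expR (t * k i)) *m X)^t* =
    X^t* *m rdiag (fun i => k i * expR (t * k i)) *m X.
  by rewrite !ctmxM trmxCK ctmx_rdiag mulmxA.
have e0 i : 0 < expR (t * k i) by apply: expR_gt0.
have [Y Yu E] := gram_rdiagonalized (fun i => k i * expR (t * k i)) Xu e0.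
rewrite /exp_path -[_ *m invmx _ *m _]mulmxA E.
have H := rdiagonalizedM Yu (erefl _) (erefl _).
rewrite H mxtrace_mulC mulmxA (mulmxV Yu) mul1mx tr_rdiag.
apply: eq_bigr => i _.
by rewrite (mulrCA _^-1 (k i)) mulVf ?gt_eqF// mulr1 expr2.
Qed.

Lemma path_length_exp_path : path_length 0 1 exp_path = Num.sqrt (\sum_i k i ^+ 2).
Proof.
have -> : path_length 0 1 exp_path =
    fine (int (fun=> Num.sqrt (\sum_i k i ^+ 2)) 0 1).
  rewrite path_lengthE; congr (fine (int _ 0 1)); apply/funext => t.
  by rewrite -(speed_exp_path t) sqrtr_sqr ger0_norm// speed_ge0.
rewrite /int integral_cst//= lebesgue_measure_itv/= lte_fin ltr01.
by rewrite oppr0 adde0 mule1.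
Qed.

End ExponentialPath.

(** * The infimum of lengths equals rho *)

Section Distance.
Local Open Scope sesquilinear_scope.
Local Open Scope complex_scope.
Local Open Scope classical_set_scope.
Local Open Scope ring_scope.
Variables (R : realType) (d : nat).
Implicit Types A B : 'M[R[i]]_d.

Lemma path_length_rho A B : posdefmx A -> posdefmx B -> exists a b f,
  path_connecting A B a b f /\ rho A B = path_length a b f.
Proof.
move=> hA hB; have [X [x [Xu x0] [AE BE _]]] := posdef_simdiag hA hB.
exists 0, 1, (exp_path X (fun i => ln (x i))); split; last first.
  rewrite path_length_exp_path// -(ger0_norm (rho_ge0 A B)) -sqrtr_sqr.
  have := rho_gram Xu (fun=> ltr01) x0; rewrite rdiag1 mulmx1 -AE -BE => ->.
  by congr Num.sqrt; apply: eq_bigr => i _; rewrite ln1 subr0.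
split; first exact: ltr01.
- exists [:: 1]; first by split; rewrite /= ?ltr01.
  case=> [|n]; last by rewrite ltnS ltn0.
  move=> _; exists (exp_path X (fun i => ln (x i))); first exact: smooth_exp_path.
  by move=> t _; reflexivity.
- by move=> t _; apply: posdef_exp_path.
- rewrite /exp_path (@eq_rdiag _ _ _ (fun=> 1)) => [|i]; last by rewrite mul0r expR0.
  by rewrite rdiag1 mulmx1 -AE.
- rewrite /exp_path (@eq_rdiag _ _ _ x) => [|i]; first by rewrite -BE.
  by rewrite mul1r lnK// posrE.
Qed.

Lemma mx_dist_rho A B : posdefmx A -> posdefmx B -> mx_dist A B = rho A B.
Proof.
move=> hA hB; have [a [b [f [cf fE]]]] := path_length_rho hA hB.
apply/eqP; rewrite eq_le; apply/andP; split.
  apply: ge_inf; last by exists a, b, f.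
  by exists 0 => _ [a' [b' [f' [_ ->]]]]; rewrite path_lengthE fine_int_speed_ge0.
apply: lb_le_inf; first by exists (rho A B), a, b, f.
by move=> _ [a' [b' [f' [/rho_le_path_length h ->]]]].
Qed.

End Distance.

(** * Block-periodic sequences *)

Section PeriodicBlocks.
Variables (T : Type) (m k : nat) (A : 'I_m -> T).
Variables (sigma : nat -> 'S_(k * m)) (X : nat -> T).
Hypotheses (m_gt0 : (0 < m)%N) (k_gt0 : (0 < k)%N).
Hypothesis X_block : forall (j : nat) (i : 'I_(k * m)),
  X (j * (k * m) + i).+1 = repeat_family A (sigma j i).

Lemma block_sequence_in n : (0 < n)%N -> exists j, X n = A j.
Proof.
case: n => // n _; have N0 : (0 < k * m)%N by rewrite muln_gt0 k_gt0.
have := X_block (n %/ (k * m)) (Ordinal (ltn_pmod n N0)).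
by rewrite /= -divn_eq => ->; eexists; reflexivity.
Qed.

Lemma sum_repeat_family (R : comNzRingType) (f : T -> R) :
  \sum_(i < k * m) f (repeat_family A i) = k%:R * \sum_(j < m) f (A j).
Proof.
case: m m_gt0 A => // m' _ A'.
(* Written through [inord], the summand depends on a plain natural number, so that the sum can be
   cut copy by copy. *)
have E (i : 'I_(k * m'.+1)) : f (repeat_family A' i) = f (A' (inord (i %% m'.+1))).
  congr (f (A' _)); apply: val_inj; by rewrite /= inordK// ltn_pmod.
under eq_bigr do rewrite E.
rewrite -(big_mkord xpredT (fun i => f (A' (inord (i %% m'.+1))))).
elim: k => [|q IH]; first by rewrite big_geq// mul0r.
rewrite mulSnr (@big_cat_nat _ _ _ (q * m'.+1)%N) ?leq_addr//= IH.
rewrite -[X in \sum_(X <= _ < _) _]add0n big_addn addKn.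
rewrite big_mkord -natr1 mulrDl mul1r; congr (_ + _); apply: eq_bigr => j _.
by rewrite addnC modnMDl modn_small// inord_val.
Qed.

Lemma sum_block_sequence (R : comNzRingType) (f : T -> R) q :
  \sum_(i < k * m) f (X (q * (k * m) + i).+1) = k%:R * \sum_(j < m) f (A j).
Proof.
under eq_bigr do rewrite X_block.
by rewrite -sum_repeat_family [RHS](reindex_inj (@perm_inj _ (sigma q))).
Qed.

End PeriodicBlocks.

(* sigma j stands for the permutation sigma_(j+1) of the indices 0, ..., km - 1;
   X is the sequence A_sigma^(k), with terms X 1, X 2, ... *)
Theorem corollary1p5 (R : realType) (d m k : nat) (hm : (0 < m)%N) (hk : (0 < k)%N)
    (A : 'I_m -> 'M[R[i]]_d) (hA : forall i, posdefmx (A i))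
    (sigma : nat -> 'S_(k * m)) (X : nat -> 'M[R[i]]_d)
    (hX : forall (j : nat) (i : 'I_(k * m)),
        X (j * (k * m) + i).+1 = repeat_family A (sigma j i)) :
  exists2 L : R, 0 < L &
    forall n : nat, (1 <= n)%N ->
      mx_dist (inductive_mean X n) (geometric_mean A) ^+ 2 <= L / n%:R.
Proof.
have geoP (B C : 'M[R[i]]_d) (t : R) : posdefmx B -> posdefmx C -> 0 <= t <= 1 ->
    posdefmx (mx_geodesic B C t) by move=> hB hC _; exact: posdef_geodesic.
have npc (B C D : 'M[R[i]]_d) (t : R) : posdefmx B -> posdefmx C -> posdefmx D ->
    0 <= t <= 1 -> rho D (mx_geodesic B C t) ^+ 2 <=
    (1 - t) * rho D B ^+ 2 + t * rho D C ^+ 2 - t * (1 - t) * rho B C ^+ 2.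
  by move=> hB hC hD t01; exact: rho_npc.
have costE (B : 'M[R[i]]_d) : posdefmx B ->
    \sum_(j < m) mx_dist (A j) B ^+ 2 = \sum_(j < m) rho (A j) B ^+ 2.
  by move=> hB; apply: eq_bigr => j _; rewrite (mx_dist_rho (hA j) hB).
have [G0 PG0 minG0] := barycenter_exists geoP (@rho_ge0 R d) (@rho_sym R d)
  npc (@rho_complete R d) hm hA.
pose minimizer C := posdefmx C /\ forall B, posdefmx B ->
    \sum_(j < m) mx_dist (A j) C ^+ 2 <= \sum_(j < m) mx_dist (A j) B ^+ 2.
(* [xget] returns its default unless the set is inhabited; the barycenter for [rho] inhabits it,
   since the costs for [mx_dist] and [rho] agree on positive definite matrices. *)
have [PG minG] : minimizer (geometric_mean A).
  apply: (@xgetPex _ 1%:M minimizer); exists G0; split; first exact: PG0.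
  by move=> B PB; rewrite (costE _ PG0) (costE _ PB); apply: minG0.
have X_in := block_sequence_in hm hk hX.
have posX n : (0 < n)%N -> posdefmx (X n) by move=> /X_in[j ->]; exact: hA.
have S_succ n : (0 < n)%N -> inductive_mean X n.+1 =
    mx_geodesic (inductive_mean X n) (X n.+1) n.+1%:R^-1 by case: n.
have posS n : (0 < n)%N -> posdefmx (inductive_mean X n).
  elim: n => [h|n IH _]; first by case: (notF h).
  have [->|n0] := posnP n; first exact: posX.
  by rewrite (S_succ _ n0); exact: (posdef_geodesic _ (IH n0) (posX _ (ltn0Sn n))).
have minG' B : posdefmx B -> \sum_(j < m) rho (A j) (geometric_mean A) ^+ 2 <=
    \sum_(j < m) rho (A j) B ^+ 2.
  by move=> hB; rewrite -(costE _ PG) -(costE _ hB); exact: minG.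
have [L L0 hL] := inductive_mean_rate geoP (@rho_ge0 R d) (@rho_sym R d)
  (@rho_refl R d) npc hm hA (erefl (k * m)%N) hk X_in
  (fun f q => sum_block_sequence hm hX f q) (erefl _) S_succ PG minG'.
exists L; first exact: L0.
by move=> n n0; rewrite mx_dist_rho; [exact: hL|exact: posS|exact: PG].
Qed.
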